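(* Let $N\in\mathbb{N}$. The following growth and decay estimates hold as $i,j\to+\infty$. (a) Each of $\omega_0\omega_i\overline{\mathbb{F}}_{10ji}$, $\omega_0\omega_i\overline{\mathbb{F}}_{20ji}$, $\omega_0\omega_i\overline{\mathbb{F}}_{30ji}$, $\omega_0\omega_i\overline{\mathbb{F}}_{40ji}$, $\omega_0\omega_i\overline{\mathbb{G}}_{0ji}$ is $\mathcal{O}(\omega_i)$ if $\omega_i-\omega_j\not\to\infty$, and is $$\sum_\pm\mathcal{O}\left(\frac{\omega_i}{(\omega_i\pm\omega_j)^p}\right)\quad\text{if }\omega_i-\omega_j\to\infty,$$ with $p=9$ for $\overline{\mathbb{F}}_{10ji}$, $p=11$ for $\overline{\mathbb{F}}_{20ji}$, and $p=3$ for $\overline{\mathbb{F}}_{30ji}$, $\overline{\mathbb{F}}_{40ji}$, $\overline{\mathbb{G}}_{0ji}$. (b) Each of $\overline{\mathbb{Q}}_{a0ji}$, $\frac{\mathbb{Q}_{a0ji}}{\omega_i}$ ($a=1,2,3,4$), $\overline{\mathbb{I}}_{0ji}$, $\frac{\mathbb{I}_{0ji}}{\omega_i}$, $\omega_0^2\overline{\mathbb{R}}_{00ji}$, $\frac{\omega_0^2\mathbb{R}_{00ji}}{\omega_i}$, $\overline{\mathbb{S}}_{00ji}$, $\frac{\mathbb{S}_{00ji}}{\omega_i}$ is $\mathcal{O}(\omega_i^{-1})$ if $\omega_i-\omega_j\not\to\infty$, and is $$\frac{1}{\omega_i}\sum_\pm\mathcal{O}\left(\frac{1}{(\omega_i\pm\omega_j)^p}\right)\quad\text{if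 }\omega_i-\omega_j\to\infty,$$ with $p=11$ for $\overline{\mathbb{Q}}_{10ji},\mathbb{Q}_{10ji}$; $p=13$ for $\overline{\mathbb{Q}}_{20ji},\mathbb{Q}_{20ji}$; $p=5$ for $\overline{\mathbb{Q}}_{30ji},\mathbb{Q}_{30ji},\overline{\mathbb{Q}}_{40ji},\mathbb{Q}_{40ji},\overline{\mathbb{I}}_{0ji},\mathbb{I}_{0ji}$; and $p=N$ for $\overline{\mathbb{R}}_{00ji},\mathbb{R}_{00ji},\overline{\mathbb{S}}_{00ji},\mathbb{S}_{00ji}$. (c) The following functions $F$ (the weights associated with the Fourier constants named in parentheses after the functions) have the following first non-vanishing derivative $F^{(n)}(\pi/2)\ne0$: $n=8$ for $F=\Gamma_1e_0'$; $n=10$ for $F=\Gamma_2e_0'$; $n=2$ for $F=\Gamma_3e_0'$, $F=\Gamma_4e_0'$ and $F=e_0'$ (constants $\overline{\mathbb{F}}_{10ji},\overline{\mathbb{F}}_{20ji},\overline{\mathbb{F}}_{30ji},\overline{\mathbb{F}}_{40ji},\overline{\mathbb{G}}_{0ji}$ respectively); $n=10$ for $F=\Gamma_1e_0\sin\cos$; $n=12$ for $F=\Gamma_2e_0\sin\cos$; $n=4$ for $F=\Gamma_3e_0\sin\cos$, $F=\Gamma_4e_0\sin\cos$ and $F=e_0\sin\cos$ (constants with letters $\mathbb{Q}_{10ji},\mathbb{Q}_{20ji},\mathbb{Q}_{30ji},\mathbb{Q}_{40ji},\mathbb{I}_{0ji}$ respectively); and none for $F=(e_0')^2\sin\cos$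 (constants $\mathbb{R}_{00ji},\overline{\mathbb{R}}_{00ji}$) and $F=e_0^2\sin\cos$ (constants $\mathbb{S}_{00ji},\overline{\mathbb{S}}_{00ji}$).
   Context: For integers $i\ge 0$ and $x\in[0,\pi/2]$ set $\omega_i:=3+2i$ and $$e_i(x):=2\frac{\sqrt{i!\,(i+2)!}}{\Gamma(i+\frac32)}\cos^3(x)\,P_i^{(\frac12,\frac32)}(\cos(2x)),$$ where $P_i^{(\alpha,\beta)}$ are the Jacobi polynomials (Szegő's normalization); $e_i'$ is the derivative of $e_i$. Let $$\Gamma_1(x):=\frac{\cos^3(x)}{\sin(x)}\int_0^x(e_0'(y))^2\tan^2(y)\,dy,\qquad \Gamma_2(x):=\omega_0^2\frac{\cos^3(x)}{\sin(x)}\int_0^x(e_0(y))^2\tan^2(y)\,dy,$$ $$\Gamma_3(x):=\int_0^x(e_0'(y))^2\sin(y)\cos(y)\,dy,\qquad \Gamma_4(x):=\omega_0^2\int_0^x(e_0(y))^2\sin(y)\cos(y)\,dy.$$ Write $g_i(x):=\int_x^{\pi/2}e_i(y)\sin(y)\cos(y)\,dy$. The Fourier constants are (for $a\in\{1,2,3,4\}$) $$\overline{\mathbb{F}}_{akji}:=\int_0^{\pi/2}\Gamma_a\,e_j\frac{e_i'}{\omega_i}\frac{e_k'}{\omega_k}\tan^2dx,\qquad \overline{\mathbb{G}}_{kji}:=\int_0^{\pi/2}e_j\frac{e_i'}{\omega_i}\frac{e_k'}{\omega_k}\tan^2dx,$$ $$\mathbb{Q}_{ajki}:=\int_0^{\pi/2}\Gamma_ae_je_k\frac{e_i'}{\omega_i}\frac{\sin^3}{\cos}dx,\qquad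 \overline{\mathbb{Q}}_{ajki}:=\int_0^{\pi/2}\Gamma_ae_je_k\,g_i\tan^2dx,$$ $$\mathbb{I}_{jki}:=\int_0^{\pi/2}e_je_k\frac{e_i'}{\omega_i}\frac{\sin^3}{\cos}dx,\qquad \overline{\mathbb{I}}_{jki}:=\int_0^{\pi/2}e_je_k\,g_i\tan^2dx,$$ $$\mathbb{R}_{klji}:=\int_0^{\pi/2}e_j\frac{e_k'}{\omega_k}\frac{e_l'}{\omega_l}\frac{e_i'}{\omega_i}\frac{\sin^3}{\cos}dx,\qquad \overline{\mathbb{R}}_{klji}:=\int_0^{\pi/2}e_j\frac{e_k'}{\omega_k}\frac{e_l'}{\omega_l}\,g_i\tan^2dx,$$ $$\mathbb{S}_{jkli}:=\int_0^{\pi/2}e_je_ke_l\frac{e_i'}{\omega_i}\frac{\sin^3}{\cos}dx,\qquad \overline{\mathbb{S}}_{jkli}:=\int_0^{\pi/2}e_je_ke_l\,g_i\tan^2dx.$$ Indices $0$ (as in $\overline{\mathbb{F}}_{a0ji}$, $\overline{\mathbb{G}}_{0ji}$, $\mathbb{Q}_{a0ji}$, $\mathbb{I}_{0ji}$, $\mathbb{R}_{00ji}$, $\mathbb{S}_{00ji}$) mean that the index in the corresponding position is set equal to $0$; e.g. $\overline{\mathbb{F}}_{a0ji}=\int_0^{\pi/2}\Gamma_a e_j\frac{e_i'}{\omega_i}\frac{e_0'}{\omega_0}\tan^2dx$ and $\mathbb{R}_{00ji}=\int_0^{\pi/2}e_j\left(\frac{e_0'}{\omega_0}\right)^2\frac{e_i'}{\omega_i}\frac{\sin^3}{\cos}dx$.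 Conventions. $\sum_\pm$ is the sum over the two choices $\omega_i+\omega_j$ and $\omega_i-\omega_j$. The estimates are understood along arbitrary sequences of pairs $(i,j)$ with both indices tending to $+\infty$; ''$\omega_i-\omega_j\to\infty$'' means that it tends to $+\infty$ along the sequence. $\sum_\pm\mathcal{O}(f_\pm)$ denotes a quantity bounded in absolute value, for all sufficiently large indices along the sequence, by a constant (possibly depending on $N$) times $\sum_\pm|f_\pm|$. ''First non-vanishing derivative $F^{(n)}(\pi/2)\ne0$'' (here $n$ even) means: $F^{(q)}(0)=F^{(q)}(\pi/2)=0$ for all even $0\le q<n$, and $F^{(n)}(\pi/2)\neq0$; ''none'' means that $F^{(q)}(0)=F^{(q)}(\pi/2)=0$ for all even $q\ge0$. Values at endpoints are understood by continuous extension. *)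

(* Defs.v *)
From Stdlib Require Import Reals Factorial.
From Coquelicot Require Import Coquelicot.
Open Scope R_scope.

(** Euler's integral; meaningful for [0 < z]. *)
Definition Euler_Gamma (z : R) : R :=
  RInt_gen (fun t => Rpower t (z - 1) * exp (- t))
    (at_right 0) (Rbar_locally p_infty).

(** Rising factorial [a (a + 1) ... (a + k - 1)]. *)
Fixpoint pochhammer (a : R) (k : nat) : R :=
  match k with
  | O => 1
  | S k' => pochhammer a k' * (a + INR k')
  end.

(** Szegő, Orthogonal Polynomials, (4.21.2):
    [binom(n + alpha, n) * 2F1(-n, n + alpha + beta + 1; alpha + 1; (1-x)/2)],
    so that the value at [1] is [binom(n + alpha, n)]. *)
Definition jacobi (n : nat) (alpha beta x : R) : R :=
  pochhammer (alpha + 1) n / INR (fact n) *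
  sum_n (fun k =>
    pochhammer (- INR n) k * pochhammer (INR n + alpha + beta + 1) k
      / (pochhammer (alpha + 1) k * INR (fact k)) * ((1 - x) / 2) ^ k) n.

Definition omega (i : nat) : R := 3 + 2 * INR i.

Definition e (i : nat) (x : R) : R :=
  2 * (sqrt (INR (fact i) * INR (fact (i + 2))) / Euler_Gamma (INR i + 3 / 2))
  * cos x ^ 3 * jacobi i (1 / 2) (3 / 2) (cos (2 * x)).

Definition e' (i : nat) (x : R) : R := Derive (e i) x.

(** Here and below an integrand may involve a division by zero at an endpoint
    of the interval of integration; [RInt] does not depend on its value there.
    At [x = 0], [Gamma1] and [Gamma2] take the value [0] of their continuous
    extension, the integral from [0] to [0] being zero. *)
Definition Gamma1 (x : R) : R :=
  cos x ^ 3 / sin x * RInt (fun y => e' 0 y ^ 2 * tan y ^ 2) 0 x.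
Definition Gamma2 (x : R) : R :=
  omega 0 ^ 2 * (cos x ^ 3 / sin x) *
  RInt (fun y => e 0 y ^ 2 * tan y ^ 2) 0 x.
Definition Gamma3 (x : R) : R :=
  RInt (fun y => e' 0 y ^ 2 * sin y * cos y) 0 x.
Definition Gamma4 (x : R) : R :=
  omega 0 ^ 2 * RInt (fun y => e 0 y ^ 2 * sin y * cos y) 0 x.

Definition g (i : nat) (x : R) : R :=
  RInt (fun y => e i y * sin y * cos y) x (PI / 2).

(** The index [a] of a Fourier constant enters only through the weight
    [Gamma_a], which is passed as the function [G]. The other indices are in
    the order of the subscripts. *)
Definition FFbar (G : R -> R) (k j i : nat) : R :=
  RInt (fun x => G x * e j x * (e' i x / omega i) * (e' k x / omega k)
                 * tan x ^ 2) 0 (PI / 2).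
Definition GGbar (k j i : nat) : R :=
  RInt (fun x => e j x * (e' i x / omega i) * (e' k x / omega k)
                 * tan x ^ 2) 0 (PI / 2).
Definition QQ (G : R -> R) (j k i : nat) : R :=
  RInt (fun x => G x * e j x * e k x * (e' i x / omega i)
                 * (sin x ^ 3 / cos x)) 0 (PI / 2).
Definition QQbar (G : R -> R) (j k i : nat) : R :=
  RInt (fun x => G x * e j x * e k x * g i x * tan x ^ 2) 0 (PI / 2).
Definition II (j k i : nat) : R :=
  RInt (fun x => e j x * e k x * (e' i x / omega i)
                 * (sin x ^ 3 / cos x)) 0 (PI / 2).
Definition IIbar (j k i : nat) : R :=
  RInt (fun x => e j x * e k x * g i x * tan x ^ 2) 0 (PI / 2).
Definition RR (k l j i : nat) : R :=
  RInt (fun x => e j x * (e' k x / omega k) * (e' l x / omega l)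
                 * (e' i x / omega i) * (sin x ^ 3 / cos x)) 0 (PI / 2).
Definition RRbar (k l j i : nat) : R :=
  RInt (fun x => e j x * (e' k x / omega k) * (e' l x / omega l)
                 * g i x * tan x ^ 2) 0 (PI / 2).
Definition SS (j k l i : nat) : R :=
  RInt (fun x => e j x * e k x * e l x * (e' i x / omega i)
                 * (sin x ^ 3 / cos x)) 0 (PI / 2).
Definition SSbar (j k l i : nat) : R :=
  RInt (fun x => e j x * e k x * e l x * g i x * tan x ^ 2) 0 (PI / 2).

Definition to_infty (s : nat -> nat) : Prop := filterlim s eventually eventually.

Definition gap_to_infty (i j : nat -> nat) : Prop :=
  is_lim_seq (fun m => omega (i m) - omega (j m)) p_infty.

(** [X i j] is [O(near i j)] along the sequences of pairs with
    [omega_i - omega_j] not tending to [+oo], and [O(far i j)] along those with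
    [omega_i - omega_j -> +oo]; the constants do not depend on the sequence. *)
Definition estimate (X near far : nat -> nat -> R) : Prop :=
  (exists C : R, forall i j : nat -> nat, to_infty i -> to_infty j ->
     ~ gap_to_infty i j ->
     eventually (fun m => Rabs (X (i m) (j m)) <= C * Rabs (near (i m) (j m))))
  /\
  (exists C : R, forall i j : nat -> nat, to_infty i -> to_infty j ->
     gap_to_infty i j ->
     eventually (fun m => Rabs (X (i m) (j m)) <= C * Rabs (far (i m) (j m)))).

Definition sum_pm (f : R -> R -> R) (i j : nat) : R :=
  Rabs (f (omega i) (omega i + omega j)) + Rabs (f (omega i) (omega i - omega j)).

Definition growth (p : nat) (X : nat -> nat -> R) : Prop :=
  estimate X (fun i _ => omega i) (sum_pm (fun w d => w / d ^ p)).

Definition decay (p : nat) (X : nat -> nat -> R) : Prop :=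
  estimate X (fun i _ => / omega i)
    (fun i j => / omega i * sum_pm (fun _ d => 1 / d ^ p) i j).

(** Derivatives at the endpoints of [[0, PI/2]] are the continuous extensions
    of the derivatives in the interior. *)
Definition smooth_inside (F : R -> R) (q : nat) : Prop :=
  forall x, 0 < x < PI / 2 -> ex_derive_n F q x.
Definition deriv_at_0 (F : R -> R) (q : nat) (l : R) : Prop :=
  smooth_inside F q /\ filterlim (Derive_n F q) (at_right 0) (locally l).
Definition deriv_at_PI2 (F : R -> R) (q : nat) (l : R) : Prop :=
  smooth_inside F q /\ filterlim (Derive_n F q) (at_left (PI / 2)) (locally l).

Definition first_nonvanishing (F : R -> R) (n : nat) : Prop :=
  Nat.Even n /\
  (forall q, Nat.Even q -> (q < n)%nat ->
     deriv_at_0 F q 0 /\ deriv_at_PI2 F q 0) /\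
  exists l, l <> 0 /\ deriv_at_PI2 F n l.

Definition none_nonvanishing (F : R -> R) : Prop :=
  forall q, Nat.Even q -> deriv_at_0 F q 0 /\ deriv_at_PI2 F q 0.

(* Main.v *)
Require Import Defs.
From Stdlib Require Import Reals ZArith List Lra Lia Bool.
From Coquelicot Require Import Coquelicot.
Import ListNotations.
Open Scope R_scope.

(** The proof rests on closed forms. Up to a constant [mode_coef i] of size
    [1 / omega i], the eigenfunction is [e_i = omega_i cot x sin (omega_i x) -
    cos (omega_i x)] ([e_mode]): both sides solve the same singular second order
    equation with the same value at [0], and an energy that decreases along
    solutions forces them to agree ([singular_ode_unique]). The derivative and
    the primitive [g_i] are then elementary as well ([e'_comode], [g_modes]), and
    [e_0] is a multiple of [cos^3]. Clearing denominators turns every Fourier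
    constant into a combination of the two kernels [mixed_kernel] and
    [plain_kernel], that is, of integrals over [[0, PI/2]] of a fixed weight
    against a sine or a cosine of one of the even frequencies
    [omega_i + omega_j] and [omega_i - omega_j].

    Such an integral is estimated by parts. A sine integral picks up the even
    derivatives of the weight at the endpoints and a cosine integral the odd
    ones, so its size is governed by the first of them that does not vanish
    ([sin_coef_order], [cos_coef_order]); this is where the endpoint derivatives
    of the third part of the theorem meet the exponents of the first two parts.
    Size alone is not enough, because some terms are only divided by [omega_j],
    which may be much smaller than the gap. The leading term, however, has the
    form [(-1)^m l / (2m)^p] at frequency [2m], and the half frequencies of the
    sum and of the difference differ by the odd number [omega_j]: adding the two
    integrals cancels the leading terms up to [omega_j] times one more inverse
    power of the gap ([alternating_order_cancel]).

    The endpoint derivatives are computed. All weights lie in the ring generated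
    by [cos], [sin] and one more function, which accounts for the integrals
    defining [Gamma_1] and [Gamma_2]. These contain a term linear in [x], so that
    [Gamma_1] and [Gamma_2] involve [x / sin x], which is not a trigonometric
    polynomial. Reducing [int sin^(2m)] to [int sin^(2m+2)] repeatedly isolates
    that part in [sin16_ratio], the quotient of [int_0^x sin^16] by [sin^16], and
    leaves it multiplied by a power of [sin] high enough to survive all the
    differentiations needed. On lists of monomials, differentiation and
    evaluation at the endpoints are exact integer computations, sound by
    [is_derive_eval], [eval_0] and [eval_PI2]. For the weights of [RR] and [SS], which
    are products of an odd power of [cos] and an odd power of [sin], parity gives
    the vanishing of all even derivatives at once
    ([odd_odd_even_derivatives_vanish]). *)

(** * The ratio of [int sin^16] to [sin^16] *)

Definition sin_power_integral (m : nat) (x : R) : R :=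
  RInt (fun t => sin t ^ (2 * m)) 0 x.

(** The value at [0] is [0 / 0 = 0], which is also the limit. Each differentiation
    may cost a factor [sin] in front of this function; the exponent [16] leaves room
    for the [14] derivatives taken of the weight that needs most. *)
Definition sin16_ratio (x : R) : R := sin_power_integral 8 x / sin x ^ 16.

Lemma continuous_of_is_derive (f : R -> R) (x l : R) :
  is_derive f x l -> continuous f x.
Proof.
  intros H. apply @ex_derive_continuous. now exists l.
Qed.

Lemma is_derive_primitive (f : R -> R) (a x : R) :
  (forall y, continuous f y) -> is_derive (fun z => RInt f a z) x (f x).
Proof.
  intros Hf. apply (is_derive_RInt f _ a x).
  - apply filter_forall. intros y.
    apply (RInt_correct (V := R_CompleteNormedModule)).
    apply (ex_RInt_continuous (V := R_CompleteNormedModule)). intros z _. apply Hf.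
  - apply Hf.
Qed.

Lemma continuous_sin_pow (n : nat) (x : R) : continuous (fun t => sin t ^ n) x.
Proof.
  apply continuous_of_is_derive with (INR n * cos x * sin x ^ pred n).
  apply is_derive_pow. apply is_derive_sin.
Qed.

Lemma is_derive_sin_power_integral (m : nat) (x : R) :
  is_derive (sin_power_integral m) x (sin x ^ (2 * m)).
Proof.
  apply (is_derive_primitive (fun t => sin t ^ (2 * m)) 0 x).
  intros y. apply continuous_sin_pow.
Qed.

Lemma sin_power_integral_0 (m : nat) : sin_power_integral m 0 = 0.
Proof. apply (RInt_point (V := R_CompleteNormedModule)). Qed.

Lemma sin16_ratio_0 : sin16_ratio 0 = 0.
Proof. unfold sin16_ratio. rewrite sin_power_integral_0. unfold Rdiv. ring. Qed.

Lemma Rabs_sin_le (x y : R) :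
  Rabs y <= Rabs x -> Rabs x <= PI / 2 -> Rabs (sin y) <= Rabs (sin x).
Proof.
  assert (A : forall z, Rabs z <= PI / 2 -> Rabs (sin z) = sin (Rabs z)).
  { intros z Hz. pose proof PI_RGT_0. unfold Rabs at 2. destruct (Rcase_abs z) as [Hn|Hp].
    - rewrite sin_neg. rewrite Rabs_left1; auto.
      rewrite Rabs_left in Hz by auto.
      assert (0 <= sin (- z)) by (apply sin_ge_0; lra). rewrite sin_neg in *. lra.
    - rewrite Rabs_pos_eq; auto. rewrite Rabs_pos_eq in Hz by lra.
      apply sin_ge_0; lra. }
  intros H1 H2. rewrite !A by lra.
  pose proof (Rabs_pos x). pose proof (Rabs_pos y). pose proof PI_RGT_0.
  apply sin_incr_1; lra.
Qed.

(** By the mean value theorem the integral is [x * sin^16 y] with [y] between [0]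
    and [x], and [|sin|] is monotone in [|x|] up to [PI / 2]. *)
Lemma Rabs_sin16_ratio_le (x : R) : Rabs x <= PI / 2 -> Rabs (sin16_ratio x) <= Rabs x.
Proof.
  intros Hx. unfold sin16_ratio.
  destruct (MVT_gen (sin_power_integral 8) 0 x (fun t => sin t ^ (2 * 8))) as [y [Hy E]].
  - intros z _. apply is_derive_sin_power_integral.
  - intros z _. apply continuity_pt_filterlim.
    apply continuous_of_is_derive with (1 := is_derive_sin_power_integral 8 z).
  - rewrite sin_power_integral_0, !Rminus_0_r in E. rewrite E.
    change (2 * 8)%nat with 16%nat.
    assert (Hyx : Rabs y <= Rabs x).
    { revert Hy. unfold Rmin, Rmax. destruct (Rle_dec 0 x) as [Hp|Hp]; intros Hy.
      - rewrite !Rabs_pos_eq; lra.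
      - rewrite !Rabs_left1; lra. }
    pose proof (Rabs_sin_le x y Hyx Hx) as Hs.
    destruct (Req_dec (sin x) 0) as [H0|H0].
    + rewrite H0 at 1. rewrite pow_i by lia. unfold Rdiv. rewrite Rinv_0, Rmult_0_r, Rabs_R0.
      apply Rabs_pos.
    + unfold Rdiv. rewrite !Rabs_mult, Rabs_inv, <- !RPow_abs.
      assert (Hp : 0 < Rabs (sin x) ^ 16) by (apply pow_lt, Rabs_pos_lt; auto).
      assert (Hq : Rabs (sin y) ^ 16 <= Rabs (sin x) ^ 16)
        by (apply pow_incr; split; auto using Rabs_pos).
      pose proof (Rabs_pos x).
      apply (Rmult_le_reg_r (Rabs (sin x) ^ 16)); auto.
      replace (Rabs (sin y) ^ 16 * Rabs x * / Rabs (sin x) ^ 16 * Rabs (sin x) ^ 16)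
        with (Rabs x * Rabs (sin y) ^ 16) by (field; apply Rgt_not_eq; apply Rabs_pos_lt; auto).
      apply Rmult_le_compat_l; auto.
Qed.

(** Gives differentiability at the one point where [sin16_ratio] is not a quotient
    of smooth functions. *)
Lemma is_derive_0_of_square_bound (f : R -> R) (r : R) :
  0 < r -> (forall x, Rabs x <= r -> Rabs (f x) <= Rabs x * Rabs x) ->
  is_derive f 0 0.
Proof.
  intros Hr Hf. apply is_derive_Reals. intros eps Heps.
  assert (Hd : 0 < Rmin r eps) by (apply Rmin_pos; auto).
  exists (mkposreal _ Hd). intros h Hh Hlt. simpl in Hlt.
  pose proof (Rmin_l r eps). pose proof (Rmin_r r eps).
  assert (f 0 = 0) as ->.
  { pose proof (Hf 0) as H1. rewrite Rabs_R0 in H1.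
    assert (H2 : Rabs (f 0) <= 0) by (specialize (H1 ltac:(lra)); lra).
    destruct (Req_dec (f 0) 0) as [E|E]; auto. apply Rabs_pos_lt in E. lra. }
  rewrite Rplus_0_l, !Rminus_0_r. unfold Rdiv. rewrite Rabs_mult, Rabs_inv.
  pose proof (Rabs_pos_lt _ Hh).
  assert (Hb : Rabs (f h) <= Rabs h * Rabs h) by (apply Hf; lra).
  apply Rle_lt_trans with (Rabs h); [|lra].
  apply (Rmult_le_reg_r (Rabs h)); auto.
  rewrite Rmult_assoc, Rinv_l, Rmult_1_r by lra. auto.
Qed.

Lemma sin_pos_open (x : R) : 0 < x <= PI / 2 -> 0 < sin x.
Proof. intros H. pose proof PI_RGT_0. apply sin_gt_0; lra. Qed.

Lemma cos_pos_open (x : R) : 0 < x < PI / 2 -> 0 < cos x.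
Proof. intros H. apply cos_gt_0; lra. Qed.

Lemma is_derive_sin16_ratio (x : R) :
  sin x <> 0 -> is_derive sin16_ratio x (1 - 16 * cos x / sin x * sin16_ratio x).
Proof.
  intros H. unfold sin16_ratio.
  evar_last.
  - apply is_derive_div.
    + apply is_derive_sin_power_integral.
    + apply is_derive_pow. apply is_derive_sin.
    + apply pow_nonzero; auto.
  - cbn [Nat.pred Nat.mul Nat.add]. rewrite (INR_IZR_INZ 16). cbn [Z.of_nat].
    simpl (IZR _). field. auto.
Qed.

(** One factor [sin] absorbs the pole of the derivative
    [1 - 16 cot x * sin16_ratio x], so the formula also holds at [x = 0]. *)
Lemma is_derive_sin_pow_sin16_ratio (b : nat) (x : R) : 0 <= x <= PI / 2 ->
  is_derive (fun t => sin t ^ S b * sin16_ratio t) x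
    ((INR (S b) - 16) * cos x * sin x ^ b * sin16_ratio x + sin x ^ S b).
Proof.
  intros Hx. destruct (Req_dec x 0) as [->|Hx0].
  - rewrite sin16_ratio_0, sin_0.
    replace (_ + 0 ^ S b) with 0 by (simpl; ring).
    pose proof PI_RGT_0.
    apply (is_derive_0_of_square_bound _ (PI / 2)); [lra|].
    intros y Hy. rewrite Rabs_mult. pose proof (Rabs_sin16_ratio_le y Hy).
    assert (Rabs (sin y) <= Rabs y).
    { destruct (MVT_gen sin 0 y cos) as [z [_ Hz]].
      - intros; apply is_derive_sin.
      - intros; apply continuity_sin.
      - rewrite sin_0, !Rminus_0_r in Hz. rewrite Hz, Rabs_mult.
        rewrite <- (Rmult_1_l (Rabs y)) at 2. apply Rmult_le_compat_r; [apply Rabs_pos|].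
        apply Rabs_le, COS_bound. }
    apply Rmult_le_compat; auto using Rabs_pos.
    simpl. rewrite Rabs_mult, <- RPow_abs.
    rewrite <- (Rmult_1_r (Rabs y)). apply Rmult_le_compat; auto using Rabs_pos.
    apply pow_le, Rabs_pos.
    rewrite <- (pow1 b). apply pow_incr. split; [apply Rabs_pos|].
    apply Rabs_le, SIN_bound.
  - assert (Hs : 0 < sin x) by (apply sin_pos_open; lra).
    evar_last.
    + apply (is_derive_mult (fun t => sin t ^ S b) sin16_ratio).
      * apply is_derive_pow. apply is_derive_sin.
      * apply is_derive_sin16_ratio. lra.
      * intros; apply Rmult_comm.
    + unfold plus, mult; simpl Nat.pred. cbn -[INR]. field. lra.
Qed.

Lemma continuous_sin16_ratio (x : R) : 0 <= x <= PI / 2 -> continuous sin16_ratio x.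
Proof.
  intros Hx. destruct (Req_dec x 0) as [->|Hx0].
  - pose proof PI2_1.
    apply continuity_pt_filterlim. intros eps Heps.
    exists (Rmin eps 1). split; [apply Rmin_pos; lra|].
    intros y [_ Hy]. simpl in *. unfold R_dist in *. rewrite sin16_ratio_0, !Rminus_0_r in *.
    pose proof (Rmin_l eps 1). pose proof (Rmin_r eps 1).
    apply Rle_lt_trans with (Rabs y); [apply Rabs_sin16_ratio_le|]; lra.
  - apply continuous_of_is_derive with (1 - 16 * cos x / sin x * sin16_ratio x).
    apply is_derive_sin16_ratio. apply Rgt_not_eq, sin_pos_open. lra.
Qed.

(** * A differential ring of trigonometric functions *)

(** The term [coef * cos^cexp * sin^sexp], times [sin16_ratio] if [has_ratio]. *)
Record monomial := Mono { coef : Z; cexp : nat; sexp : nat; has_ratio : bool }.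
Definition trigpoly := list monomial.

Definition eval_mono (t : monomial) (x : R) : R :=
  IZR (coef t) * cos x ^ cexp t * sin x ^ sexp t * (if has_ratio t then sin16_ratio x else 1).

Fixpoint eval (p : trigpoly) (x : R) : R :=
  match p with
  | [] => 0
  | t :: p' => eval_mono t x + eval p' x
  end.

Definition same_shape (t u : monomial) : bool :=
  Nat.eqb (cexp t) (cexp u) && Nat.eqb (sexp t) (sexp u)
  && Bool.eqb (has_ratio t) (has_ratio u).

(** Like terms have to be merged: without this the number of monomials would grow
    exponentially with the order of the derivative. *)
Fixpoint add_mono (t : monomial) (p : trigpoly) : trigpoly :=
  match p with
  | [] => [t]
  | u :: p' =>
      if same_shape t u
      then Mono (coef t + coef u) (cexp u) (sexp u) (has_ratio u) :: p'
      else u :: add_mono t p'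
  end.

(** Terms with exponent [0] are dropped instead of being kept with coefficient [0],
    so that differentiation flips the parities of both exponents of every monomial. *)
Definition deriv_mono (t : monomial) : trigpoly :=
  let '(Mono z a b l) := t in
  match a with
  | O => []
  | S a' => [Mono (- z * Z.of_nat a) a' (S b) l]
  end ++
  if l then [Mono (z * (Z.of_nat b - 16)) (S a) (pred b) true; Mono z a b false]
  else match b with
       | O => []
       | S b' => [Mono (z * Z.of_nat b) (S a) b' false]
       end.

Definition deriv (p : trigpoly) : trigpoly :=
  fold_right add_mono [] (flat_map deriv_mono p).

(** A monomial that contains [sin16_ratio] can be differentiated at [0] within the
    ring only if it carries a factor [sin]. *)
Definition differentiable (p : trigpoly) : bool :=
  forallb (fun t => negb (has_ratio t) || Nat.ltb 0 (sexp t)) p.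

Definition mul_mono (z : Z) (a b : nat) (p : trigpoly) : trigpoly :=
  map (fun t => Mono (z * coef t) (a + cexp t) (b + sexp t) (has_ratio t)) p.

Definition value_at_0 (p : trigpoly) : Z :=
  fold_right (fun t acc =>
    if negb (has_ratio t) && Nat.eqb (sexp t) 0 then (coef t + acc)%Z else acc) 0%Z p.

(** The value at [PI / 2] of the part with ([l = true]) or without ([l = false]) the
    factor [sin16_ratio]. The two parts are kept apart because the number
    [sin16_ratio (PI / 2)] is a rational multiple of [PI], while coefficients are
    integers. *)
Definition value_at_PI2 (l : bool) (p : trigpoly) : Z :=
  fold_right (fun t acc =>
    if Bool.eqb (has_ratio t) l && Nat.eqb (cexp t) 0 then (coef t + acc)%Z else acc) 0%Z p.

Lemma eval_app (p q : trigpoly) (x : R) : eval (p ++ q) x = eval p x + eval q x.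
Proof. induction p as [|t p IH]; simpl; [ring|rewrite IH; ring]. Qed.

Lemma eval_add_mono (t : monomial) (p : trigpoly) (x : R) :
  eval (add_mono t p) x = eval_mono t x + eval p x.
Proof.
  induction p as [|u p IH]; simpl; [ring|].
  destruct (same_shape t u) eqn:E.
  - unfold same_shape in E. apply andb_prop in E as [E E3]. apply andb_prop in E as [E1 E2].
    apply Nat.eqb_eq in E1, E2. apply eqb_prop in E3.
    simpl. unfold eval_mono. simpl. rewrite plus_IZR, E1, E2, E3. ring.
  - simpl. rewrite IH. ring.
Qed.

Lemma eval_fold_add_mono (p : trigpoly) (x : R) :
  eval (fold_right add_mono [] p) x = eval p x.
Proof. induction p as [|t p IH]; simpl; [|rewrite eval_add_mono, IH]; reflexivity. Qed.

Lemma eval_mul_mono (z : Z) (a b : nat) (p : trigpoly) (x : R) :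
  eval (mul_mono z a b p) x = IZR z * cos x ^ a * sin x ^ b * eval p x.
Proof.
  induction p as [|t p IH]; simpl; [ring|]. rewrite IH. unfold eval_mono. simpl.
  rewrite mult_IZR, !pow_add. ring.
Qed.

Lemma is_derive_cos_pow (a : nat) (x : R) :
  is_derive (fun t => cos t ^ a) x (- INR a * sin x * cos x ^ pred a).
Proof.
  evar_last. apply is_derive_pow. apply is_derive_cos. cbn -[INR]. ring.
Qed.

Lemma is_derive_eval_mono (t : monomial) (x : R) : 0 <= x <= PI / 2 ->
  negb (has_ratio t) || Nat.ltb 0 (sexp t) = true ->
  is_derive (eval_mono t) x (eval (deriv_mono t) x).
Proof.
  intros Hx Hv. destruct t as [z a b l]. simpl in Hv.
  apply (is_derive_ext (fun y => IZR z
    * (cos y ^ a * (sin y ^ b * (if l then sin16_ratio y else 1))))).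
  { intros y. unfold eval_mono. simpl. ring. }
  set (db := if l then (INR b - 16) * cos x * sin x ^ pred b * sin16_ratio x + sin x ^ b
             else INR b * cos x * sin x ^ pred b).
  assert (Hb : is_derive (fun y => sin y ^ b * (if l then sin16_ratio y else 1)) x db).
  { unfold db. destruct l.
    - destruct b as [|b]; [discriminate|]. apply (is_derive_sin_pow_sin16_ratio b x Hx).
    - apply (is_derive_ext (fun y => sin y ^ b)). { intros y. apply eq_sym, Rmult_1_r. }
      evar_last. apply is_derive_pow. apply is_derive_sin. cbn -[INR]. ring. }
  evar_last.
  - apply (is_derive_scal (fun y => cos y ^ a
      * (sin y ^ b * (if l then sin16_ratio y else 1)))).
    apply (is_derive_mult (fun y => cos y ^ a)
      (fun y => sin y ^ b * (if l then sin16_ratio y else 1))).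
    + apply is_derive_cos_pow.
    + exact Hb.
    + intros; apply Rmult_comm.
  - unfold db, plus, mult. cbn -[INR IZR]. unfold deriv_mono. rewrite eval_app.
    destruct a as [|a], l, b as [|b]; try discriminate; unfold eval, eval_mono;
    cbn [coef cexp sexp has_ratio pred]; repeat rewrite ?mult_IZR, ?opp_IZR, ?minus_IZR;
      rewrite <- ?INR_IZR_INZ; rewrite ?INR_0; simpl pow; ring.
Qed.

Lemma is_derive_eval (p : trigpoly) (x : R) : 0 <= x <= PI / 2 ->
  differentiable p = true -> is_derive (eval p) x (eval (deriv p) x).
Proof.
  intros Hx Hv. unfold deriv. rewrite eval_fold_add_mono.
  induction p as [|t p IH].
  - apply (is_derive_const (K := R_AbsRing) (V := R_NormedModule) 0 x).
  - simpl in Hv. apply andb_prop in Hv as [Ht Hp].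
    simpl. rewrite eval_app. apply (is_derive_plus (eval_mono t) (eval p)); auto.
    apply is_derive_eval_mono; auto.
Qed.

Lemma continuous_eval (p : trigpoly) (x : R) : 0 <= x <= PI / 2 -> continuous (eval p) x.
Proof.
  intros Hx. induction p as [|t p IH].
  - apply continuous_const.
  - apply (continuous_plus (eval_mono t) (eval p)); auto.
    unfold eval_mono. destruct t as [z a b l]. cbn [coef cexp sexp has_ratio].
    apply (continuous_mult (fun y => IZR z * cos y ^ a * sin y ^ b)).
    + apply (continuous_mult (fun y => IZR z * cos y ^ a)).
      * apply (continuous_mult (fun y => IZR z)); [apply continuous_const|].
        eapply continuous_of_is_derive, is_derive_cos_pow.
      * apply continuous_sin_pow.
    + destruct l; [apply continuous_sin16_ratio; auto|apply continuous_const].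
Qed.

Lemma eval_0 (p : trigpoly) : eval p 0 = IZR (value_at_0 p).
Proof.
  induction p as [|[z a b l] p IH]; auto. simpl eval. rewrite IH. unfold eval_mono.
  cbn [value_at_0 fold_right coef cexp sexp has_ratio]. rewrite cos_0, sin_0, pow1.
  fold (value_at_0 p).
  destruct l; simpl; [rewrite sin16_ratio_0; ring|].
  destruct b as [|b]; simpl; rewrite ?plus_IZR; ring.
Qed.

Lemma eval_PI2 (p : trigpoly) :
  eval p (PI / 2) = IZR (value_at_PI2 false p) + IZR (value_at_PI2 true p)
    * sin16_ratio (PI / 2).
Proof.
  induction p as [|[z a b l] p IH]; [simpl; ring|]. simpl eval. rewrite IH. unfold eval_mono.
  cbn [value_at_PI2 fold_right coef cexp sexp has_ratio]. rewrite cos_PI2, sin_PI2, pow1.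
  fold (value_at_PI2 false p). fold (value_at_PI2 true p).
  destruct l, a as [|a]; simpl; rewrite ?plus_IZR; ring.
Qed.

Definition vanishes_at_PI2 (p : trigpoly) : bool :=
  Z.eqb (value_at_PI2 false p) 0 && Z.eqb (value_at_PI2 true p) 0.

(** The even derivatives of order below [2k] vanish at both ends of [[0, PI/2]], and
    the derivative of order [2k] vanishes at [0]. Every derivative up to order
    [2k + 2] is guaranteed to be represented in the ring. *)
Fixpoint even_derivatives_vanish (k : nat) (p : trigpoly) : bool :=
  differentiable p && differentiable (deriv p) && Z.eqb (value_at_0 p) 0 &&
  match k with
  | O => true
  | S k' => vanishes_at_PI2 p && even_derivatives_vanish k' (deriv (deriv p))
  end.

(** Parity classes of polynomials without [sin16_ratio]: [a] and [b] tell whether the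
    exponents of [cos] and of [sin] are odd. *)
Definition parity (a b : bool) (p : trigpoly) : bool :=
  forallb (fun t => negb (has_ratio t) && Bool.eqb (Nat.odd (cexp t)) a
                      && Bool.eqb (Nat.odd (sexp t)) b) p.

Lemma parity_add_mono a b t p :
  parity a b [t] = true -> parity a b p = true -> parity a b (add_mono t p) = true.
Proof.
  unfold parity. simpl. rewrite andb_true_r. intros Ht.
  induction p as [|u p IH]; simpl; intros Hp; [rewrite Ht; auto|].
  apply andb_prop in Hp as [Hu Hp].
  destruct (same_shape t u); simpl; rewrite ?Hu, ?Hp; auto.
Qed.

Lemma parity_deriv a b p :
  parity a b p = true -> parity (negb a) (negb b) (deriv p) = true.
Proof.
  intros Hp. unfold deriv.
  assert (H : parity (negb a) (negb b) (flat_map deriv_mono p) = true).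
  { unfold parity. apply forallb_forall. intros t Ht. apply in_flat_map in Ht as [u [Hu Ht]].
    unfold parity in Hp. rewrite forallb_forall in Hp. specialize (Hp _ Hu).
    destruct u as [z c d l]. cbn [coef cexp sexp has_ratio] in Hp.
    apply andb_prop in Hp as [Hp H3]. apply andb_prop in Hp as [H1 H2].
    apply eqb_prop in H2, H3. subst a b. destruct l; [discriminate|].
    unfold deriv_mono in Ht. apply in_app_or in Ht as [Ht|Ht].
    - destruct c as [|c]; [destruct Ht|]. destruct Ht as [<-|[]].
      cbn [coef cexp sexp has_ratio]. rewrite !Nat.odd_succ, <- !Nat.negb_odd, negb_involutive.
      rewrite !eqb_reflx. auto.
    - destruct d as [|d]; [destruct Ht|]. destruct Ht as [<-|[]].
      cbn [coef cexp sexp has_ratio]. rewrite !Nat.odd_succ, <- !Nat.negb_odd, negb_involutive.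
      rewrite !eqb_reflx. auto. }
  induction (flat_map deriv_mono p) as [|t q IH]; auto.
  unfold parity in H. simpl in H. apply andb_prop in H as [H1 H2].
  apply parity_add_mono; [unfold parity; simpl; rewrite H1; auto|apply IH, H2].
Qed.

Lemma parity_differentiable a b p : parity a b p = true -> differentiable p = true.
Proof.
  unfold parity, differentiable. rewrite !forallb_forall. intros H t Ht.
  specialize (H t Ht). destruct (has_ratio t); [discriminate|auto].
Qed.

Lemma odd_sin_value_at_0 a p : parity a true p = true -> value_at_0 p = 0%Z.
Proof.
  induction p as [|t p IH]; auto. unfold parity. simpl. intros H.
  apply andb_prop in H as [H H']. rewrite (IH H').
  destruct (sexp t); [rewrite andb_comm in H; discriminate|]. rewrite andb_false_r; auto.
Qed.

Lemma odd_cos_value_at_PI2 l b p : parity true b p = true -> value_at_PI2 l p = 0%Z.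
Proof.
  induction p as [|t p IH]; auto. unfold parity. simpl. intros H.
  apply andb_prop in H as [H H']. rewrite (IH H').
  destruct (cexp t); [simpl in H; rewrite andb_false_r in H; discriminate|].
  rewrite andb_false_r; auto.
Qed.

(** Two differentiations preserve the class of odd powers of [cos] times odd powers
    of [sin], all of which vanish at both endpoints. *)
Lemma odd_odd_even_derivatives_vanish p k :
  parity true true p = true -> even_derivatives_vanish k p = true.
Proof.
  revert p. induction k as [|k IH]; intros p Hp; simpl;
    rewrite (parity_differentiable _ _ _ Hp),
      (parity_differentiable _ _ _ (parity_deriv _ _ _ Hp)),
      (odd_sin_value_at_0 _ _ Hp); auto.
  unfold vanishes_at_PI2. rewrite !(odd_cos_value_at_PI2 _ _ _ Hp). simpl.
  apply IH. apply (parity_deriv _ _ _ (parity_deriv _ _ _ Hp)).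
Qed.

(** A denominator [d] and a polynomial [p] with
    [sin x * p x = d * int_0^x sin^(2m)], provided that [m + n = 8]: the [n] steps
    apply the reduction formula until the power [16] is reached. *)
Fixpoint sin_power_quotient (m n : nat) : Z * trigpoly :=
  match n with
  | O => (1%Z, [Mono 1 0 15 true])
  | S n' =>
      let '(d, p) := sin_power_quotient (S m) n' in
      ((2 * Z.of_nat m + 1) * d,
        Mono d 1 (2 * m) false :: mul_mono (2 * Z.of_nat m + 2) 0 0 p)%Z
  end.

Lemma RInt_of_derive (F f : R -> R) (a b : R) :
  (forall x, is_derive F x (f x)) -> (forall x, continuous f x) ->
  RInt f a b = F b - F a.
Proof.
  intros H1 H2. apply is_RInt_unique. apply (is_RInt_derive F f); auto.
Qed.

Lemma cos_sq x : cos x ^ 2 = 1 - sin x ^ 2.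
Proof. pose proof (sin2_cos2 x). unfold Rsqr in *. simpl. lra. Qed.

Lemma continuous_cos_sin_pow (a b : nat) (x : R) :
  continuous (fun t => cos t ^ a * sin t ^ b) x.
Proof.
  apply (continuous_mult (fun t => cos t ^ a)).
  eapply continuous_of_is_derive, is_derive_cos_pow. apply continuous_sin_pow.
Qed.

Lemma is_derive_cos_sin_pow (a b : nat) (x : R) :
  is_derive (fun t => cos t ^ a * sin t ^ b) x
    (INR b * cos x ^ S a * sin x ^ pred b - INR a * cos x ^ pred a * sin x ^ S b).
Proof.
  evar_last.
  - apply (is_derive_mult (fun t => cos t ^ a)).
    apply is_derive_cos_pow. apply is_derive_pow, is_derive_sin. intros; apply Rmult_comm.
  - unfold plus, mult; cbn -[INR]. ring.
Qed.

(** Integration of [(cos * sin^(2m+1))' = (2m+1) sin^(2m) - (2m+2) sin^(2m+2)]. *)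
Lemma sin_power_integral_succ (m : nat) (x : R) :
  (2 * INR m + 1) * sin_power_integral m x
  = cos x * sin x ^ (2 * m + 1) + (2 * INR m + 2) * sin_power_integral (S m) x.
Proof.
  assert (H : RInt (fun t => (2 * INR m + 1) * sin t ^ (2 * m)) 0 x =
    (cos x ^ 1 * sin x ^ (2 * m + 1) + (2 * INR m + 2) * sin_power_integral (S m) x)
    - (cos 0 ^ 1 * sin 0 ^ (2 * m + 1) + (2 * INR m + 2) * sin_power_integral (S m) 0)).
  { apply (RInt_of_derive (fun x => cos x ^ 1 * sin x ^ (2 * m + 1)
                            + (2 * INR m + 2) * sin_power_integral (S m) x)).
    - intros y. evar_last.
      + apply (is_derive_plus (fun x => cos x ^ 1 * sin x ^ (2 * m + 1))).
        apply is_derive_cos_sin_pow.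
        apply (is_derive_scal (sin_power_integral (S m))), is_derive_sin_power_integral.
      + replace (2 * m + 1)%nat with (S (2 * m)) by lia.
        replace (2 * S m)%nat with (S (S (2 * m))) by lia.
        change plus with Rplus. rewrite cos_sq, S_INR, mult_INR. cbn -[Nat.mul INR].
        simpl (INR 2). simpl (INR 1). ring.
    - intros y. apply (continuous_scal_r (V := R_NormedModule) _ (fun t => sin t ^ (2 * m))).
      apply continuous_sin_pow. }
  rewrite (RInt_scal (V := R_CompleteNormedModule)) in H.
  2: { apply (ex_RInt_continuous (V := R_CompleteNormedModule)).
       intros; apply continuous_sin_pow. }
  change scal with Rmult in H. cbv beta in H. unfold sin_power_integral at 1. rewrite H.
  rewrite sin_0, sin_power_integral_0, pow_i, pow_1 by lia. ring.
Qed.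

Lemma eval_sin_power_quotient (m n : nat) (x : R) : (m + n = 8)%nat -> 0 <= x <= PI / 2 ->
  sin x * eval (snd (sin_power_quotient m n)) x
  = IZR (fst (sin_power_quotient m n)) * sin_power_integral m x.
Proof.
  intros Hmn Hx. revert m Hmn. induction n as [|n IH]; intros m Hmn.
  - replace m with 8%nat by lia. cbn [sin_power_quotient fst snd eval].
    unfold eval_mono, sin16_ratio.
    cbn [coef cexp sexp has_ratio].
    destruct (Req_dec x 0) as [->|H0].
    + rewrite sin_power_integral_0, sin_0. ring.
    + assert (0 < sin x) by (apply sin_pos_open; lra). simpl (cos x ^ 0). field. lra.
  - cbn [sin_power_quotient]. specialize (IH (S m) ltac:(lia)).
    destruct (sin_power_quotient (S m) n) as [d p]. cbn [fst snd] in *.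
    cbn [eval]. unfold eval_mono. cbn [coef cexp sexp has_ratio]. rewrite eval_mul_mono.
    rewrite mult_IZR, !plus_IZR, !mult_IZR, <- INR_IZR_INZ.
    replace ((2 * INR m + 1) * IZR d * sin_power_integral m x)
      with (IZR d * ((2 * INR m + 1) * sin_power_integral m x)) by ring.
    rewrite sin_power_integral_succ, pow_add. simpl (cos x ^ 0). simpl (sin x ^ 0).
    replace (sin x * _) with (IZR d * (cos x * (sin x ^ (2 * m) * sin x ^ 1))
       + (2 * INR m + 2) * (sin x * eval p x)) by ring.
    rewrite IH. ring.
Qed.

(** Represents [5 d int_0^x cos^2 sin^4 / sin x], with [d] the denominator for
    [int sin^6], by [(cos * sin^5)' = 5 cos^2 sin^4 - sin^6]. *)
Definition quotient24 : trigpoly :=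
  let '(d, p) := sin_power_quotient 3 5 in Mono d 1 4 false :: p.
(** Represents [15 d int_0^x cos^4 sin^2 / sin x], by
    [(cos^3 sin^3)' = 3 cos^4 sin^2 - 3 cos^2 sin^4]. *)
Definition quotient42 : trigpoly :=
  Mono (5 * fst (sin_power_quotient 3 5)) 3 2 false :: mul_mono 3 0 0 quotient24.
Definition quotient_denominator : Z := 5 * fst (sin_power_quotient 3 5).

Lemma RInt_cos2_sin4 (x : R) : 0 <= x <= PI / 2 ->
  RInt (fun t => cos t ^ 2 * sin t ^ 4) 0 x
  = sin x * eval quotient24 x / IZR quotient_denominator :> R.
Proof.
  intros Hx.
  rewrite (RInt_of_derive (fun t => / 5 * (cos t ^ 1 * sin t ^ 5 + sin_power_integral 3 t))).
  - rewrite sin_0, sin_power_integral_0.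
    pose proof (eval_sin_power_quotient 3 5 x eq_refl Hx) as E.
    unfold quotient_denominator, quotient24.
    assert (Hd : IZR (fst (sin_power_quotient 3 5)) <> 0)
      by (apply (eq_IZR_contrapositive _ 0%Z); discriminate).
    destruct (sin_power_quotient 3 5) as [d p]. cbn [fst snd] in *. cbn [eval].
    rewrite mult_IZR, (Rmult_plus_distr_l (sin x)), E. unfold eval_mono.
    cbn [coef cexp sexp has_ratio].
    field. auto.
  - intros t. evar_last.
    + apply (is_derive_scal (fun t => cos t ^ 1 * sin t ^ 5 + sin_power_integral 3 t)).
      apply (is_derive_plus (fun t => cos t ^ 1 * sin t ^ 5)).
      apply is_derive_cos_sin_pow. apply is_derive_sin_power_integral.
    + change plus with Rplus. rewrite cos_sq. simpl. field.
  - intros t. apply continuous_cos_sin_pow.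
Qed.

Lemma RInt_cos4_sin2 (x : R) : 0 <= x <= PI / 2 ->
  RInt (fun t => cos t ^ 4 * sin t ^ 2) 0 x
  = sin x * eval quotient42 x / (3 * IZR quotient_denominator) :> R.
Proof.
  intros Hx.
  rewrite (RInt_of_derive (fun t => / 3 * (cos t ^ 3 * sin t ^ 3)
             + RInt (fun t => cos t ^ 2 * sin t ^ 4) 0 t)).
  - rewrite RInt_cos2_sin4 by auto. rewrite (RInt_point (V := R_CompleteNormedModule)).
    change zero with 0. rewrite sin_0.
    unfold quotient42. fold quotient_denominator. cbn [eval]. rewrite eval_mul_mono.
    unfold eval_mono. cbn [coef cexp sexp has_ratio].
    assert (Hd : IZR quotient_denominator <> 0)
      by (apply (eq_IZR_contrapositive _ 0%Z); discriminate).
    field. auto.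
  - intros t. evar_last.
    + apply (is_derive_plus (fun t => / 3 * (cos t ^ 3 * sin t ^ 3))).
      * apply (is_derive_scal (fun t => cos t ^ 3 * sin t ^ 3)), is_derive_cos_sin_pow.
      * apply is_derive_primitive. apply continuous_cos_sin_pow.
    + change plus with Rplus. simpl. field.
  - intros t. apply continuous_cos_sin_pow.
Qed.

Lemma RInt_cos5_sin3 (x : R) :
  RInt (fun t => cos t ^ 5 * sin t ^ 3) 0 x
  = eval [Mono 6 0 4 false; Mono (-8) 0 6 false; Mono 3 0 8 false] x / 24 :> R.
Proof.
  rewrite (RInt_of_derive
    (fun t => / 4 * sin t ^ 4 - / 3 * sin t ^ 6 + / 8 * sin t ^ 8)).
  - rewrite sin_0. unfold eval, eval_mono. simpl. field.
  - intros t. evar_last. auto_derive; auto.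
    replace (cos t ^ 5) with (cos t * (cos t ^ 2 * cos t ^ 2)) by ring.
    rewrite cos_sq. simpl. field.
  - intros t. apply continuous_cos_sin_pow.
Qed.

Lemma RInt_cos7_sin (x : R) :
  RInt (fun t => cos t ^ 7 * sin t ^ 1) 0 x
  = eval [Mono 1 0 0 false; Mono (-1) 8 0 false] x / 8 :> R.
Proof.
  rewrite (RInt_of_derive (fun t => - / 8 * cos t ^ 8)).
  - rewrite cos_0. unfold eval, eval_mono. simpl. field.
  - intros t. evar_last. auto_derive; auto. simpl. field.
  - intros t. apply continuous_cos_sin_pow.
Qed.

(** * Oscillatory integrals *)

Definition sin_coef (p : trigpoly) (m : nat) : R :=
  RInt (fun x => eval p x * sin (2 * INR m * x)) 0 (PI / 2).
Definition cos_coef (p : trigpoly) (m : nat) : R :=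
  RInt (fun x => eval p x * cos (2 * INR m * x)) 0 (PI / 2).

Lemma is_derive_sin_freq (w x : R) : is_derive (fun y => sin (w * y)) x (w * cos (w * x)).
Proof. auto_derive; auto. ring. Qed.
Lemma is_derive_cos_freq (w x : R) : is_derive (fun y => cos (w * y)) x (- w * sin (w * x)).
Proof. auto_derive; auto. ring. Qed.

Lemma continuous_sin_freq (w x : R) : continuous (fun y => sin (w * y)) x.
Proof. eapply continuous_of_is_derive, is_derive_sin_freq. Qed.
Lemma continuous_cos_freq (w x : R) : continuous (fun y => cos (w * y)) x.
Proof. eapply continuous_of_is_derive, is_derive_cos_freq. Qed.

Lemma ex_RInt_quarter (f : R -> R) :
  (forall x, 0 <= x <= PI / 2 -> continuous f x) -> ex_RInt f 0 (PI / 2).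
Proof.
  intros H. apply (ex_RInt_continuous (V := R_CompleteNormedModule)).
  pose proof PI_RGT_0. intros z. rewrite Rmin_left, Rmax_right by lra. apply H.
Qed.

Lemma continuous_eval_sin p w x : 0 <= x <= PI / 2 ->
  continuous (fun y => eval p y * sin (w * y)) x.
Proof.
  intros Hx. apply (continuous_mult (eval p)).
  apply continuous_eval, Hx. apply continuous_sin_freq.
Qed.
Lemma continuous_eval_cos p w x : 0 <= x <= PI / 2 ->
  continuous (fun y => eval p y * cos (w * y)) x.
Proof.
  intros Hx. apply (continuous_mult (eval p)).
  apply continuous_eval, Hx. apply continuous_cos_freq.
Qed.

Lemma cos_nat_PI (m : nat) : cos (INR m * PI) = (-1) ^ m.
Proof.
  induction m as [|m IH]; [simpl; rewrite Rmult_0_l, cos_0; auto|].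
  rewrite S_INR, Rmult_plus_distr_r, Rmult_1_l, neg_cos, IH. simpl. ring.
Qed.
Lemma sin_nat_PI (m : nat) : sin (INR m * PI) = 0.
Proof.
  induction m as [|m IH]; [simpl; rewrite Rmult_0_l, sin_0; auto|].
  rewrite S_INR, Rmult_plus_distr_r, Rmult_1_l, neg_sin, IH. ring.
Qed.

Lemma two_INR_pos m : (1 <= m)%nat -> 2 <= 2 * INR m.
Proof. intros H. apply le_INR in H. simpl in H. lra. Qed.

Lemma RInt_quarter_of_derive (f df : R -> R) :
  (forall x, 0 <= x <= PI / 2 -> is_derive f x (df x)) ->
  (forall x, 0 <= x <= PI / 2 -> continuous df x) ->
  RInt df 0 (PI / 2) = f (PI / 2) - f 0.
Proof.
  intros H1 H2. pose proof PI_RGT_0.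
  apply is_RInt_unique. apply (is_RInt_derive f df);
  intros z; rewrite Rmin_left, Rmax_right by lra; auto.
Qed.

(** At [PI / 2] the cosine of frequency [2m] equals [(-1)^m]: this is the source of
    the alternating leading terms below. *)
Lemma sin_coef_by_parts (p : trigpoly) (m : nat) : (1 <= m)%nat ->
  differentiable p = true ->
  sin_coef p m = (eval p 0 - (-1) ^ m * eval p (PI / 2)) / (2 * INR m)
                 + cos_coef (deriv p) m / (2 * INR m).
Proof.
  intros Hm Hp. pose proof (two_INR_pos m Hm) as Hw. set (w := 2 * INR m) in *.
  assert (E : RInt (fun x => w * (eval p x * sin (w * x))
                             - eval (deriv p) x * cos (w * x)) 0 (PI / 2)
              = - (eval p (PI / 2) * cos (w * (PI / 2))) - - (eval p 0 * cos (w * 0))).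
  { apply (RInt_quarter_of_derive (fun x => - (eval p x * cos (w * x)))).
    - intros x Hx. evar_last.
      + apply (is_derive_opp (V := R_NormedModule) (fun y => eval p y * cos (w * y))).
        apply (is_derive_mult (eval p)).
        * apply is_derive_eval; auto.
        * apply is_derive_cos_freq.
        * intros; apply Rmult_comm.
      + unfold opp, plus, mult; simpl. ring.
    - intros x Hx. apply (continuous_minus (V := R_NormedModule)).
      + apply (continuous_scal_r (V := R_NormedModule) w). apply continuous_eval_sin, Hx.
      + apply continuous_eval_cos, Hx. }
  rewrite (RInt_minus (V := R_CompleteNormedModule)) in E.
  2: { apply (ex_RInt_scal (V := R_NormedModule)). apply ex_RInt_quarter.
       intros; apply continuous_eval_sin; auto. }
  2: { apply ex_RInt_quarter. intros; apply continuous_eval_cos; auto. }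
  rewrite (RInt_scal (V := R_CompleteNormedModule)) in E.
  2: { apply ex_RInt_quarter. intros; apply continuous_eval_sin; auto. }
  unfold minus, plus, opp, scal in E; simpl in E. unfold mult in E; simpl in E.
  replace (w * (PI / 2)) with (INR m * PI) in E by (unfold w; field).
  rewrite cos_nat_PI, Rmult_0_r, cos_0 in E.
  unfold sin_coef, cos_coef. fold w. 
  apply (Rmult_eq_reg_l w); [|lra].
  match type of E with ?a + - ?b = _ => replace (w * _) with (a + - b + b) by ring end.
  rewrite E. field. lra.
Qed.

(** No boundary term: sines of even frequency vanish at both endpoints. *)
Lemma cos_coef_by_parts (p : trigpoly) (m : nat) : (1 <= m)%nat ->
  differentiable p = true ->
  cos_coef p m = - sin_coef (deriv p) m / (2 * INR m).
Proof.
  intros Hm Hp. pose proof (two_INR_pos m Hm) as Hw. set (w := 2 * INR m) in *.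
  assert (E : RInt (fun x => w * (eval p x * cos (w * x))
                             + eval (deriv p) x * sin (w * x)) 0 (PI / 2)
              = eval p (PI / 2) * sin (w * (PI / 2)) - eval p 0 * sin (w * 0)).
  { apply (RInt_quarter_of_derive (fun x => eval p x * sin (w * x))).
    - intros x Hx. evar_last.
      + apply (is_derive_mult (eval p)).
        * apply is_derive_eval; auto.
        * apply is_derive_sin_freq.
        * intros; apply Rmult_comm.
      + unfold opp, plus, mult; simpl. ring.
    - intros x Hx. apply (continuous_plus (V := R_NormedModule)).
      + apply (continuous_scal_r (V := R_NormedModule) w). apply continuous_eval_cos, Hx.
      + apply continuous_eval_sin, Hx. }
  rewrite (RInt_plus (V := R_CompleteNormedModule)) in E.
  2: { apply (ex_RInt_scal (V := R_NormedModule)). apply ex_RInt_quarter.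
       intros; apply continuous_eval_cos; auto. }
  2: { apply ex_RInt_quarter. intros; apply continuous_eval_sin; auto. }
  rewrite (RInt_scal (V := R_CompleteNormedModule)) in E.
  2: { apply ex_RInt_quarter. intros; apply continuous_eval_cos; auto. }
  unfold minus, plus, opp, scal in E; simpl in E. unfold mult in E; simpl in E.
  replace (w * (PI / 2)) with (INR m * PI) in E by (unfold w; field).
  rewrite sin_nat_PI, !Rmult_0_r, sin_0 in E.
  unfold sin_coef, cos_coef. fold w.
  apply (Rmult_eq_reg_l w); [|lra].
  match type of E with ?a + ?b = _ => replace (w * _) with (a + b - b) by ring end.
  rewrite E. field. lra.
Qed.

Lemma eval_bounded (p : trigpoly) :
  exists C, 0 <= C /\ forall x, 0 <= x <= PI / 2 -> Rabs (eval p x) <= C.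
Proof.
  pose proof PI_RGT_0.
  destruct (continuity_ab_maj (fun x => Rabs (eval p x)) 0 (PI / 2)) as [M [HM _]]; [lra| |].
  - intros c Hc. apply continuity_pt_filterlim.
    apply (continuous_comp (eval p) Rabs); [apply continuous_eval; auto|].
    apply continuous_Rabs.
  - exists (Rabs (eval p M)). split; [apply Rabs_pos|exact HM].
Qed.

Lemma RInt_quarter_bound (f : R -> R) (C : R) :
  (forall x, 0 <= x <= PI / 2 -> continuous f x) ->
  (forall x, 0 <= x <= PI / 2 -> Rabs (f x) <= C) ->
  Rabs (RInt f 0 (PI / 2)) <= PI / 2 * C.
Proof.
  intros H1 H2. pose proof PI_RGT_0.
  replace (PI / 2 * C) with ((PI / 2 - 0) * C) by ring.
  apply abs_RInt_le_const; [lra| |auto]. apply ex_RInt_quarter; auto.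
Qed.

Lemma sin_coef_bounded (p : trigpoly) : exists C, forall m, Rabs (sin_coef p m) <= C.
Proof.
  destruct (eval_bounded p) as [C [HC H]]. exists (PI / 2 * C). intros m.
  apply RInt_quarter_bound.
  - intros; apply continuous_eval_sin; auto.
  - intros x Hx. rewrite Rabs_mult, <- (Rmult_1_r C).
    apply Rmult_le_compat; auto using Rabs_pos. apply Rabs_le, SIN_bound.
Qed.

(** The sign pattern of the leading term is recorded, and not just the size, because
    it produces the cancellation in [alternating_order_cancel]. *)
Definition alternating_order (p : nat) (J : nat -> R) : Prop :=
  exists l C, 0 <= C /\ forall m, (1 <= m)%nat ->
    Rabs (J m - (-1) ^ m * l / (2 * INR m) ^ p) <= C / (2 * INR m) ^ S p.

Lemma alternating_order_ext p J J' :
  (forall m, (1 <= m)%nat -> J m = J' m) -> alternating_order p J -> alternating_order p J'.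
Proof.
  intros E (l & C & HC & H). exists l, C. split; auto. intros m Hm. rewrite <- E; auto.
Qed.

Lemma alternating_order_div p q J :
  alternating_order p J -> alternating_order (q + p) (fun m => - J m / (2 * INR m) ^ q).
Proof.
  intros (l & C & HC & H). exists (- l), C. split; auto. intros m Hm.
  pose proof (two_INR_pos m Hm) as Hw. set (w := 2 * INR m) in *.
  assert (Hq : 0 < w ^ q) by (apply pow_lt; lra).
  assert (Hp : 0 < w ^ p) by (apply pow_lt; lra).
  replace (_ - _) with (- (J m - (-1) ^ m * l / w ^ p) / w ^ q).
  2: { rewrite pow_add. field. lra. }
  unfold Rdiv at 1. rewrite Rabs_mult, Rabs_Ropp, Rabs_inv, (Rabs_pos_eq (w ^ q)) by lra.
  apply Rle_trans with (C / w ^ S p * / w ^ q).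
  - apply Rmult_le_compat_r. left; apply Rinv_0_lt_compat; auto. apply H; auto.
  - right. rewrite <- !tech_pow_Rmult, pow_add. field. lra.
Qed.

(** Two integrations by parts divide by [(2m)^2], and each is free as long as the
    even derivatives vanish. At the last stage the weight still vanishes at [0], so
    only the boundary term at [PI / 2] survives, and it alternates. *)
Lemma sin_coef_order (k : nat) (p : trigpoly) :
  even_derivatives_vanish k p = true -> alternating_order (2 * k + 1) (sin_coef p).
Proof.
  revert p. induction k as [|k IH]; intros p Hp; simpl in Hp.
  - repeat (apply andb_prop in Hp as [Hp ?]). apply Z.eqb_eq in H0.
    destruct (sin_coef_bounded (deriv (deriv p))) as [C HC].
    assert (0 <= C)
      by (eapply Rle_trans; [apply Rabs_pos|apply (HC 0%nat)]).
    (* The boundary term at [PI / 2] is the leading term; the second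
       derivative bounds the rest. *)
    exists (- eval p (PI / 2)), C. split; auto. intros m Hm.
    rewrite sin_coef_by_parts, cos_coef_by_parts by auto.
    pose proof (two_INR_pos m Hm) as Hw. set (w := 2 * INR m) in *.
    rewrite eval_0, H0.
    replace (_ - _) with (- (sin_coef (deriv (deriv p)) m / w ^ 2)) by (simpl; field; lra).
    rewrite Rabs_Ropp. unfold Rdiv. rewrite Rabs_mult, Rabs_inv,
      (Rabs_pos_eq (w ^ 2)) by (apply pow_le; lra).
    simpl Nat.add. apply Rmult_le_compat_r; auto. left. apply Rinv_0_lt_compat, pow_lt. lra.
  - apply andb_prop in Hp as [Hp Hk]. apply andb_prop in Hk as [HP Hk].
    repeat (apply andb_prop in Hp as [Hp ?]). apply Z.eqb_eq in H.
    unfold vanishes_at_PI2 in HP. apply andb_prop in HP as [H1 H2].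
    apply Z.eqb_eq in H1, H2.
    replace (2 * S k + 1)%nat with (2 + (2 * k + 1))%nat by lia.
    eapply alternating_order_ext; [|apply (alternating_order_div _ 2 _ (IH _ Hk))].
    intros m Hm. cbv beta. rewrite (sin_coef_by_parts p), cos_coef_by_parts by auto.
    rewrite eval_0, eval_PI2, H, H1, H2. pose proof (two_INR_pos m Hm). simpl; field.
    intros E; rewrite E in *; lra.
Qed.

Lemma cos_coef_order (k : nat) (p : trigpoly) :
  differentiable p = true -> even_derivatives_vanish k (deriv p) = true ->
  alternating_order (2 * k + 2) (cos_coef p).
Proof.
  intros Hp Hk. replace (2 * k + 2)%nat with (1 + (2 * k + 1))%nat by lia.
  eapply alternating_order_ext; [|apply (alternating_order_div _ 1 _ (sin_coef_order _ _ Hk))].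
  intros m Hm. cbv beta. rewrite (cos_coef_by_parts p), pow_1; auto.
Qed.

Lemma alternating_order_bound p J : alternating_order p J ->
  exists C, 0 <= C /\ forall m, (1 <= m)%nat -> Rabs (J m) <= C / (2 * INR m) ^ p.
Proof.
  intros (l & C & HC & H). exists (Rabs l + C). split.
  { pose proof (Rabs_pos l). lra. }
  intros m Hm. specialize (H m Hm). pose proof (two_INR_pos m Hm) as Hw.
  set (w := 2 * INR m) in *.
  assert (Hp : 0 < w ^ p) by (apply pow_lt; lra).
  replace (J m) with ((J m - (-1) ^ m * l / w ^ p) + (-1) ^ m * l / w ^ p) by ring.
  eapply Rle_trans; [apply Rabs_triang|].
  rewrite (Rdiv_plus_distr (Rabs l) C).
  assert (C / w ^ S p <= C / w ^ p).
  { apply Rmult_le_compat_l; auto. apply Rinv_le_contravar; auto. simpl.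
    rewrite <- (Rmult_1_l (w ^ p)) at 1. apply Rmult_le_compat_r; lra. }
  assert (Rabs ((-1) ^ m * l / w ^ p) = Rabs l * / w ^ p) as ->.
  { unfold Rdiv. rewrite !Rabs_mult, pow_1_abs, Rabs_inv, (Rabs_pos_eq (w ^ p)) by lra. ring. }
  unfold Rdiv in *. lra.
Qed.

(** A form of Bernoulli's inequality. *)
Lemma one_minus_pow_le (r : R) (p : nat) : 0 <= r <= 1 -> 1 - r ^ p <= INR p * (1 - r).
Proof.
  intros Hr. induction p as [|p IH]; [simpl; lra|].
  rewrite S_INR. simpl.
  assert (0 <= r ^ p <= 1).
  { split; [apply pow_le; lra|]. rewrite <- (pow1 p). apply pow_incr; lra. }
  nra.
Qed.

Lemma inv_pow_diff_le (a b : R) (p : nat) : 0 < a <= b ->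
  0 <= / a ^ p - / b ^ p <= INR p * (b - a) / a ^ S p.
Proof.
  intros H. assert (Ha : 0 < a ^ p) by (apply pow_lt; lra).
  assert (Hb : 0 < b ^ p) by (apply pow_lt; lra).
  assert (Hr : 0 <= a / b <= 1).
  { split. apply Rdiv_le_0_compat; lra. apply (Rmult_le_reg_r b); [lra|].
    unfold Rdiv. rewrite Rmult_assoc, Rinv_l; lra. }
  pose proof (one_minus_pow_le _ p Hr) as H1.
  assert (E : / a ^ p - / b ^ p = / a ^ p * (1 - (a / b) ^ p)).
  { unfold Rdiv. rewrite Rpow_mult_distr, pow_inv. field. lra. }
  assert (Hi : 0 < / a ^ p) by (apply Rinv_0_lt_compat; auto).
  assert ((a / b) ^ p <= 1). { rewrite <- (pow1 p). apply pow_incr; lra. }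
  rewrite E. split.
  - apply Rmult_le_pos; lra.
  - apply Rle_trans with (/ a ^ p * (INR p * (1 - a / b))).
    + apply Rmult_le_compat_l; lra.
    + replace (INR p * (b - a) / a ^ S p) with (/ a ^ p * (INR p * ((b - a) / a))).
      2: { simpl. field. split; [apply pow_nonzero|]; lra. }
      apply Rmult_le_compat_l; [lra|]. apply Rmult_le_compat_l; [apply pos_INR|].
      replace (1 - a / b) with ((b - a) / b) by (field; lra).
      apply Rmult_le_compat_l; [lra|]. apply Rinv_le_contravar; lra.
Qed.

Lemma pow_m1_plus_odd (m j : nat) : (-1) ^ (m + (2 * j + 3)) = - (-1) ^ m.
Proof.
  rewrite pow_add. replace (2 * j + 3)%nat with (S (2 * (j + 1))) by lia.
  rewrite pow_1_odd. ring.
Qed.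

(** The shift [2j + 3 = omega_j] is odd, so the leading terms have opposite signs
    and what is left is [1/a^p - 1/b^p] with [b - a = 2 omega_j], which is
    [O(omega_j / a^(p+1))]. *)
Lemma alternating_order_cancel p J : alternating_order p J ->
  exists C, 0 <= C /\ forall m j, (1 <= m)%nat ->
    Rabs (J (m + (2 * j + 3))%nat + J m) <= C * omega j / (2 * INR m) ^ S p.
Proof.
  intros (l & C & HC & H). exists (Rabs l * INR p * 2 + 2 * C). split.
  { pose proof (Rabs_pos l). pose proof (pos_INR p). nra. }
  intros m j Hm. pose proof (H m Hm) as H1.
  pose proof (H (m + (2 * j + 3))%nat ltac:(lia)) as H2.
  pose proof (two_INR_pos m Hm) as Hw.
  (* The frequencies differ by [2 * omega j]. *)
  assert (Hw' : 2 * INR (m + (2 * j + 3)) = 2 * INR m + 2 * omega j).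
  { unfold omega. rewrite !plus_INR, mult_INR. simpl. ring. }
  rewrite pow_m1_plus_odd, Hw' in H2.
  assert (Ho : 3 <= omega j) by (unfold omega; pose proof (pos_INR j); lra).
  set (w := 2 * INR m) in *. set (n := (m + (2 * j + 3))%nat) in *.
  destruct (inv_pow_diff_le w (w + 2 * omega j) p ltac:(lra)) as [H3 H4].
  replace (w + 2 * omega j - w) with (2 * omega j) in H4 by ring.
  assert (Hp : 0 < w ^ p) by (apply pow_lt; lra).
  assert (HS : 0 < w ^ S p) by (apply pow_lt; lra).
  assert (Hp' : 0 < (w + 2 * omega j) ^ p) by (apply pow_lt; lra).
  assert (HS' : / (w + 2 * omega j) ^ S p <= / w ^ S p).
  { apply Rinv_le_contravar; auto. apply pow_incr; lra. }
  replace (J n + J m) with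
    ((J n - - (-1) ^ m * l / (w + 2 * omega j) ^ p) + (J m - (-1) ^ m * l / w ^ p)
      + (-1) ^ m * (l * (/ w ^ p - / (w + 2 * omega j) ^ p))) by (field; lra).
  eapply Rle_trans; [apply Rabs_triang|].
  eapply Rle_trans; [apply Rplus_le_compat_r, Rabs_triang|].
  rewrite Rabs_mult, pow_1_abs, Rmult_1_l, Rabs_mult, (Rabs_pos_eq _ H3).
  assert (Rabs l * (/ w ^ p - / (w + 2 * omega j) ^ p)
          <= Rabs l * (INR p * (2 * omega j) / w ^ S p))
    by (apply Rmult_le_compat_l; auto using Rabs_pos).
  assert (C / (w + 2 * omega j) ^ S p <= C / w ^ S p) by (apply Rmult_le_compat_l; auto).
  assert (C / w ^ S p * 1 <= C / w ^ S p * omega j).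
  { apply Rmult_le_compat_l; [apply Rdiv_le_0_compat; auto|lra]. }
  replace ((Rabs l * INR p * 2 + 2 * C) * omega j / w ^ S p) with
    (Rabs l * (INR p * (2 * omega j) / w ^ S p) + 2 * (C / w ^ S p * omega j)) by (field; lra).
  lra.
Qed.

(** * Two kernels built from the modes *)

(** The numerator [sin x * e_i x], without the normalization constant. *)
Definition mode (i : nat) (x : R) : R :=
  omega i * cos x * sin (omega i * x) - sin x * cos (omega i * x).
(** The numerator of [e_i'], which is proportional to [cos x * comode i x / sin^2 x]
    ([e'_comode]); it is not the derivative of [mode]. *)
Definition comode (i : nat) (x : R) : R :=
  omega i * sin x * cos (omega i * x) - cos x * sin (omega i * x).

(** Collects the integrals of [e_j e_i'] against a weight. *)
Definition mixed_kernel (w : trigpoly) (i j : nat) : R :=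
  RInt (fun x => eval w x * mode j x * comode i x) 0 (PI / 2).
(** Collects the integrals of [e_j e_i] against a weight; it comes from the second
    summand of [g_i] in [g_modes]. *)
Definition plain_kernel (w : trigpoly) (i j : nat) : R :=
  RInt (fun x => eval w x * mode j x * mode i x) 0 (PI / 2).

Lemma omega_ge_3 i : 3 <= omega i.
Proof. unfold omega. pose proof (pos_INR i). lra. Qed.

Lemma continuous_mode i x : continuous (mode i) x.
Proof.
  apply (@ex_derive_continuous R_AbsRing R_NormedModule). unfold mode. auto_derive. auto.
Qed.
Lemma continuous_comode i x : continuous (comode i) x.
Proof.
  apply (@ex_derive_continuous R_AbsRing R_NormedModule). unfold comode. auto_derive. auto.
Qed.

Lemma Rabs_combination_le (w a b c d : R) :
  1 <= w -> -1 <= a <= 1 -> -1 <= b <= 1 -> -1 <= c <= 1 -> -1 <= d <= 1 ->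
  Rabs (w * a * b - c * d) <= 2 * w.
Proof.
  intros Hw Ha Hb Hc Hd.
  assert (-1 <= a * b <= 1) by nra. assert (-1 <= c * d <= 1) by nra.
  apply Rabs_le. rewrite Rmult_assoc. nra.
Qed.

Lemma Rabs_mode_le i x : Rabs (mode i x) <= 2 * omega i.
Proof.
  pose proof (omega_ge_3 i).
  apply Rabs_combination_le; auto using COS_bound, SIN_bound; lra.
Qed.
Lemma Rabs_comode_le i x : Rabs (comode i x) <= 2 * omega i.
Proof.
  pose proof (omega_ge_3 i).
  apply Rabs_combination_le; auto using COS_bound, SIN_bound; lra.
Qed.

Lemma continuous_kernel_integrand (w : trigpoly) (u v : R -> R) (x : R) :
  continuous u x -> continuous v x -> 0 <= x <= PI / 2 ->
  continuous (fun x => eval w x * u x * v x) x.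
Proof.
  intros Hu Hv Hx. apply (continuous_mult (fun x => eval w x * u x)); auto.
  apply (continuous_mult (eval w)); auto. apply continuous_eval; auto.
Qed.

Lemma kernel_bounded (w : trigpoly) (u v : nat -> R -> R) :
  (forall i x, continuous (u i) x) -> (forall i x, continuous (v i) x) ->
  (forall i x, Rabs (u i x) <= 2 * omega i) -> (forall i x, Rabs (v i x) <= 2 * omega i) ->
  exists C, 0 <= C /\ forall i j,
    Rabs (RInt (fun x => eval w x * u j x * v i x) 0 (PI / 2)) <= C * (omega i * omega j).
Proof.
  intros Cu Cv Bu Bv. destruct (eval_bounded w) as [C [HC H]]. pose proof PI_RGT_0.
  exists (PI / 2 * (C * 4)). split; [apply Rmult_le_pos; lra|]. intros i j.
  replace (PI / 2 * (C * 4) * (omega i * omega j)) with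
    (PI / 2 * (C * (2 * omega j) * (2 * omega i))) by field.
  apply RInt_quarter_bound.
  - intros x Hx. apply continuous_kernel_integrand; auto.
  - intros x Hx. rewrite !Rabs_mult.
    repeat apply Rmult_le_compat; auto using Rabs_pos. apply Rmult_le_pos; apply Rabs_pos.
Qed.

Lemma is_RInt_sin_coef p m :
  is_RInt (fun x => eval p x * sin (2 * INR m * x)) 0 (PI / 2) (sin_coef p m).
Proof.
  apply (RInt_correct (V := R_CompleteNormedModule)), ex_RInt_quarter.
  intros; apply continuous_eval_sin; auto.
Qed.
Lemma is_RInt_cos_coef p m :
  is_RInt (fun x => eval p x * cos (2 * INR m * x)) 0 (PI / 2) (cos_coef p m).
Proof.
  apply (RInt_correct (V := R_CompleteNormedModule)), ex_RInt_quarter.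
  intros; apply continuous_eval_cos; auto.
Qed.

Lemma is_RInt_combination4 (f1 f2 f3 f4 : R -> R) (a1 a2 a3 a4 l1 l2 l3 l4 a b : R) :
  is_RInt f1 a b l1 -> is_RInt f2 a b l2 -> is_RInt f3 a b l3 -> is_RInt f4 a b l4 ->
  is_RInt (fun x => a1 * f1 x + a2 * f2 x + a3 * f3 x + a4 * f4 x) a b
    (a1 * l1 + a2 * l2 + a3 * l3 + a4 * l4).
Proof.
  intros H1 H2 H3 H4.
  apply (is_RInt_plus (V := R_NormedModule) (fun x => a1 * f1 x + a2 * f2 x + a3 * f3 x)).
  apply (is_RInt_plus (V := R_NormedModule) (fun x => a1 * f1 x + a2 * f2 x)).
  apply (is_RInt_plus (V := R_NormedModule) (fun x => a1 * f1 x)).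
  all: apply (is_RInt_scal (V := R_NormedModule)); auto.
Qed.

Lemma frequency_sum m j x :
  2 * INR (m + (2 * j + 3)) * x = omega (j + m) * x + omega j * x.
Proof. unfold omega. rewrite !plus_INR, mult_INR. simpl. ring. Qed.
Lemma frequency_difference m j x : 2 * INR m * x = omega (j + m) * x - omega j * x.
Proof. unfold omega. rewrite !plus_INR. ring. Qed.

(** Product-to-sum formulas with [i = j + m]: the difference of the frequencies is
    [2m] and their sum is [2M]. *)
Lemma mixed_kernel_expansion (w : trigpoly) (m j : nat) :
  let M := (m + (2 * j + 3))%nat in
  mixed_kernel w (j + m) j =
    omega (j + m) * omega j / 2
      * (sin_coef (mul_mono 1 1 1 w) M - sin_coef (mul_mono 1 1 1 w) m)
  + omega j / 2 * (cos_coef (mul_mono 1 2 0 w) M - cos_coef (mul_mono 1 2 0 w) m)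
  + - (omega (j + m) / 2) * (cos_coef (mul_mono 1 0 2 w) M + cos_coef (mul_mono 1 0 2 w) m)
  + / 2 * (sin_coef (mul_mono 1 1 1 w) M + sin_coef (mul_mono 1 1 1 w) m).
Proof.
  intros M. apply is_RInt_unique.
  eapply is_RInt_ext; [|apply is_RInt_combination4;
   [apply (is_RInt_minus (V := R_NormedModule)); apply is_RInt_sin_coef
   |apply (is_RInt_minus (V := R_NormedModule)); apply is_RInt_cos_coef
   |apply (is_RInt_plus (V := R_NormedModule)); apply is_RInt_cos_coef
   |apply (is_RInt_plus (V := R_NormedModule)); apply is_RInt_sin_coef]].
  intros x _. unfold M, mode, comode, minus, plus, opp; simpl plus; cbv beta.
  rewrite frequency_sum, (frequency_difference m j), !eval_mul_mono.
  rewrite !sin_plus, !sin_minus, !cos_plus, !cos_minus. simpl. field.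
Qed.

Lemma plain_kernel_expansion (w : trigpoly) (m j : nat) :
  let M := (m + (2 * j + 3))%nat in
  plain_kernel w (j + m) j =
    - (omega (j + m) * omega j / 2)
        * (cos_coef (mul_mono 1 2 0 w) M - cos_coef (mul_mono 1 2 0 w) m)
  + - (omega j / 2) * (sin_coef (mul_mono 1 1 1 w) M - sin_coef (mul_mono 1 1 1 w) m)
  + - (omega (j + m) / 2) * (sin_coef (mul_mono 1 1 1 w) M + sin_coef (mul_mono 1 1 1 w) m)
  + / 2 * (cos_coef (mul_mono 1 0 2 w) M + cos_coef (mul_mono 1 0 2 w) m).
Proof.
  intros M. apply is_RInt_unique.
  eapply is_RInt_ext; [|apply is_RInt_combination4;
   [apply (is_RInt_minus (V := R_NormedModule)); apply is_RInt_cos_coef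
   |apply (is_RInt_minus (V := R_NormedModule)); apply is_RInt_sin_coef
   |apply (is_RInt_plus (V := R_NormedModule)); apply is_RInt_sin_coef
   |apply (is_RInt_plus (V := R_NormedModule)); apply is_RInt_cos_coef]].
  intros x _. unfold M, mode, comode, minus, plus, opp; simpl plus; cbv beta.
  rewrite frequency_sum, (frequency_difference m j), !eval_mul_mono.
  rewrite !sin_plus, !sin_minus, !cos_plus, !cos_minus. simpl. field.
Qed.

Definition cos_order_check (k : nat) (p : trigpoly) : bool :=
  differentiable p && even_derivatives_vanish k (deriv p).

(** The three clauses treat the weight times [sin cos], [cos^2] and [sin^2]. The
    first needs the full order [2k + 1]; for the others order [2k] is enough, since
    they are multiplied by fewer factors [omega]. *)
Definition mixed_check (k : nat) (w : trigpoly) : bool :=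
  even_derivatives_vanish k (mul_mono 1 1 1 w)
  && cos_order_check (k - 1) (mul_mono 1 2 0 w)
  && cos_order_check (k - 1) (mul_mono 1 0 2 w).

(** Weaker than [mixed_check], because [plain_kernel] enters with an extra factor
    [1 / omega_i]. *)
Definition plain_check (k : nat) (w : trigpoly) : bool :=
  even_derivatives_vanish (k - 1) (mul_mono 1 1 1 w)
  && cos_order_check (k - 1) (mul_mono 1 2 0 w)
  && cos_order_check (k - 2) (mul_mono 1 0 2 w).

Lemma cos_coef_order_of_check k p : cos_order_check k p = true ->
  alternating_order (2 * k + 2) (cos_coef p).
Proof. intros H. apply andb_prop in H as [H1 H2]. apply cos_coef_order; auto. Qed.

(** For the terms with the difference of the two integrals, where the leading terms
    add up instead of cancelling. *)
Lemma alternating_order_diff p J : alternating_order p J ->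
  exists C, 0 <= C /\ forall m M, (1 <= m <= M)%nat ->
    Rabs (J M - J m) <= C / (2 * INR m) ^ p.
Proof.
  intros H. destruct (alternating_order_bound p J H) as (C & HC & HB).
  exists (2 * C). split; [lra|]. intros m M Hm.
  pose proof (HB m ltac:(lia)) as H1. pose proof (HB M ltac:(lia)) as H2.
  pose proof (two_INR_pos m ltac:(lia)). assert (HM : INR m <= INR M) by (apply le_INR; lia).
  assert (C / (2 * INR M) ^ p <= C / (2 * INR m) ^ p).
  { apply Rmult_le_compat_l; auto. apply Rinv_le_contravar.
    apply pow_lt; lra. apply pow_incr; lra. }
  eapply Rle_trans; [apply Rabs_triang|]. rewrite Rabs_Ropp.
  replace (2 * C / (2 * INR m) ^ p) with (C / (2 * INR m) ^ p + C / (2 * INR m) ^ p).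
  2: { field. apply pow_nonzero; lra. }
  lra.
Qed.

(** Both regimes of the estimates in one notion that involves no sequences: the plain
    bound is for gaps that do not tend to infinity, the power of the gap for those
    that do. *)
Definition gap_decay (p : nat) (b : nat -> nat -> R) (K : nat -> nat -> R) : Prop :=
  exists C, 0 <= C /\ forall i j,
    Rabs (K i j) <= C * b i j /\
    ((j < i)%nat -> Rabs (K i j) <= C * b i j / (omega i - omega j) ^ p).

Lemma Rabs_sum4_le a b c d : Rabs (a + b + c + d) <= Rabs a + Rabs b + Rabs c + Rabs d.
Proof.
  pose proof (Rabs_triang (a + b + c) d). pose proof (Rabs_triang (a + b) c).
  pose proof (Rabs_triang a b). lra.
Qed.

Lemma Rabs_scal_le a x b : 0 <= a -> Rabs x <= b -> Rabs (a * x) <= a * b.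
Proof.
  intros Ha H. rewrite Rabs_mult, (Rabs_pos_eq a) by auto. apply Rmult_le_compat_l; auto.
Qed.
Lemma Rabs_opp_scal_le a x b : 0 <= a -> Rabs x <= b -> Rabs (- a * x) <= a * b.
Proof. intros Ha H. rewrite Ropp_mult_distr_l_reverse, Rabs_Ropp. apply Rabs_scal_le; auto. Qed.

Lemma omega_sub j m : omega (j + m) - omega j = 2 * INR m.
Proof. unfold omega. rewrite plus_INR. ring. Qed.

(** Trades powers of [W] for powers of [1 / N]; used with [N] the gap and
    [W = omega_i], which exceeds it. *)
Lemma pow_shift_le (a N W : R) (p q : nat) : 0 <= a -> 0 < N <= W -> 
  a / N ^ p <= a * W ^ q / N ^ (p + q).
Proof.
  intros Ha HN. assert (0 < N ^ p) by (apply pow_lt; lra).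
  assert (0 < N ^ q) by (apply pow_lt; lra).
  replace (a / N ^ p) with (a * N ^ q / N ^ (p + q)) by (rewrite pow_add; field; lra).
  apply Rmult_le_compat_r. left; apply Rinv_0_lt_compat, pow_lt; lra.
  apply Rmult_le_compat_l; auto. apply pow_incr; lra.
Qed.

(** The term with [cos cos] carries [omega_i] but no [omega_j]. Its order is only
    [2k], and the cancellation between the two frequencies supplies both the missing
    power of the gap and the factor [omega_j]. *)
Lemma mixed_kernel_decay (k : nat) (w : trigpoly) : (1 <= k)%nat ->
  mixed_check k w = true ->
  gap_decay (2 * k + 1) (fun i j => omega i * omega j) (mixed_kernel w).
Proof.
  intros Hk Hw. apply andb_prop in Hw as [Hw H3]. apply andb_prop in Hw as [H1 H2].
  apply sin_coef_order in H1. apply cos_coef_order_of_check in H2, H3.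
  replace (2 * (k - 1) + 2)%nat with (2 * k)%nat in * by lia.
  destruct (kernel_bounded w mode comode continuous_mode continuous_comode
              Rabs_mode_le Rabs_comode_le) as (C0 & HC0 & B0).
  destruct (alternating_order_diff _ _ H1) as (C1 & HC1 & B1).
  destruct (alternating_order_diff _ _ H2) as (C2 & HC2 & B2).
  destruct (alternating_order_cancel _ _ H3) as (C3 & HC3 & B3).
  destruct (alternating_order_cancel _ _ H1) as (C4 & HC4 & B4).
  exists (C0 + C1 + C2 + C3 + C4). split; [lra|]. intros i j.
  pose proof (omega_ge_3 i) as Hi. pose proof (omega_ge_3 j) as Hj.
  assert (Hij : 0 <= omega i * omega j) by (apply Rmult_le_pos; lra).
  split.
  - eapply Rle_trans; [apply B0|]. apply Rmult_le_compat_r; auto. lra.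
  - intros Hlt. set (m := (i - j)%nat). assert (Ei : i = (j + m)%nat) by lia.
    assert (Hm : (1 <= m)%nat) by lia. rewrite Ei in Hi, Hij |- *.
    rewrite mixed_kernel_expansion, omega_sub.
    specialize (B1 m (m + (2 * j + 3))%nat ltac:(lia)).
    specialize (B2 m (m + (2 * j + 3))%nat ltac:(lia)).
    specialize (B3 m j Hm). specialize (B4 m j Hm).
    pose proof (two_INR_pos m Hm) as HN. pose proof (omega_sub j m) as HS.
    set (N := 2 * INR m) in *. set (wi := omega (j + m)) in *. set (wj := omega j) in *.
    replace (S (2 * k)) with (2 * k + 1)%nat in B3 by lia.
    set (p := (2 * k + 1)%nat) in *.
    assert (HNp : 0 < N ^ p) by (apply pow_lt; lra).
    eapply Rle_trans; [apply Rabs_sum4_le|].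
    apply (Rabs_scal_le (wi * wj / 2)) in B1; [|lra].
    apply (Rabs_scal_le (wj / 2)) in B2; [|lra].
    apply (Rabs_opp_scal_le (wi / 2)) in B3; [|lra].
    apply (Rabs_scal_le (/ 2)) in B4; [|lra].
    assert (E2 : C2 / N ^ (2 * k) <= C2 * wi ^ 1 / N ^ p)
      by (apply pow_shift_le; [lra|split; lra]).
    rewrite pow_1 in E2. apply (Rmult_le_compat_l (wj / 2)) in E2; [|lra].
    assert (E4 : C4 * wj / N ^ S p <= C4 * wj / N ^ p * wi).
    { replace (C4 * wj / N ^ S p) with (C4 * wj / N ^ p * / N) by (simpl; field; lra).
      apply Rmult_le_compat_l. apply Rdiv_le_0_compat; auto; nra.
      apply Rle_trans with 1; [|lra]. rewrite <- Rinv_1. apply Rinv_le_contravar; lra. }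
    (* Each of the four terms is at most a constant times [T]. *)
    set (T := wi * wj / N ^ p).
    assert (HT : 0 <= T) by (apply Rdiv_le_0_compat; auto).
    replace (wi * wj / 2 * (C1 / N ^ p)) with (C1 * T / 2) in B1 by (unfold T; field; lra).
    replace (wj / 2 * (C2 * wi / N ^ p)) with (C2 * T / 2) in E2 by (unfold T; field; lra).
    replace (wi / 2 * (C3 * wj / N ^ p)) with (C3 * T / 2) in B3 by (unfold T; field; lra).
    replace (C4 * wj / N ^ p * wi) with (C4 * T) in E4 by (unfold T; field; lra).
    replace ((C0 + C1 + C2 + C3 + C4) * (wi * wj) / N ^ p) with
      ((C0 + C1 + C2 + C3 + C4) * T) by (unfold T; field; lra).
    assert (0 <= C0 * T) by nra. assert (0 <= C1 * T) by nra. assert (0 <= C2 * T) by nra.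
    assert (0 <= C3 * T) by nra. assert (0 <= C4 * T) by nra. nra.
Qed.

(** As for [mixed_kernel], except that two factors of [omega_i] are available to
    replace missing powers of the gap; cancellation is used for the two terms that
    carry no [omega_j]. *)
Lemma plain_kernel_decay (k : nat) (w : trigpoly) : (2 <= k)%nat ->
  plain_check k w = true ->
  gap_decay (2 * k + 1) (fun i j => omega i ^ 2 * omega j) (plain_kernel w).
Proof.
  intros Hk Hw. apply andb_prop in Hw as [Hw H3]. apply andb_prop in Hw as [H1 H2].
  apply sin_coef_order in H1. apply cos_coef_order_of_check in H2, H3.
  replace (2 * (k - 1) + 2)%nat with (2 * k)%nat in * by lia.
  replace (2 * (k - 2) + 2)%nat with (2 * k - 2)%nat in * by lia.
  replace (2 * (k - 1) + 1)%nat with (2 * k - 1)%nat in * by lia.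
  destruct (kernel_bounded w mode mode continuous_mode continuous_mode
              Rabs_mode_le Rabs_mode_le) as (C0 & HC0 & B0).
  destruct (alternating_order_diff _ _ H2) as (C1 & HC1 & B1).
  destruct (alternating_order_diff _ _ H1) as (C2 & HC2 & B2).
  destruct (alternating_order_cancel _ _ H1) as (C3 & HC3 & B3).
  destruct (alternating_order_cancel _ _ H3) as (C4 & HC4 & B4).
  exists (C0 + C1 + C2 + C3 + C4). split; [lra|]. intros i j.
  pose proof (omega_ge_3 i) as Hi. pose proof (omega_ge_3 j) as Hj.
  assert (Hij : 0 <= omega i * omega j) by (apply Rmult_le_pos; lra).
  split.
  - eapply Rle_trans; [apply B0|].
    apply Rle_trans with ((C0 + C1 + C2 + C3 + C4) * (omega i * omega j)).
    apply Rmult_le_compat_r; auto. lra.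
    apply Rmult_le_compat_l; [lra|]. apply Rmult_le_compat_r; [lra|]. nra.
  - intros Hlt. set (m := (i - j)%nat). assert (Ei : i = (j + m)%nat) by lia.
    assert (Hm : (1 <= m)%nat) by lia. rewrite Ei in Hi, Hij |- *.
    rewrite plain_kernel_expansion, omega_sub.
    specialize (B1 m (m + (2 * j + 3))%nat ltac:(lia)).
    specialize (B2 m (m + (2 * j + 3))%nat ltac:(lia)).
    specialize (B3 m j Hm). specialize (B4 m j Hm).
    pose proof (two_INR_pos m Hm) as HN. pose proof (omega_sub j m) as HS.
    set (N := 2 * INR m) in *. set (wi := omega (j + m)) in *. set (wj := omega j) in *.
    set (p := (2 * k + 1)%nat) in *.
    assert (HNp : 0 < N ^ p) by (apply pow_lt; lra).
    eapply Rle_trans; [apply Rabs_sum4_le|].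
    apply (Rabs_opp_scal_le (wi * wj / 2)) in B1; [|lra].
    apply (Rabs_opp_scal_le (wj / 2)) in B2; [|lra].
    apply (Rabs_opp_scal_le (wi / 2)) in B3; [|lra].
    apply (Rabs_scal_le (/ 2)) in B4; [|lra].
    (* Each of the four terms is at most a constant times [T]. *)
    set (T := wi ^ 2 * wj / N ^ p).
    assert (HT : 0 <= T).
    { apply Rdiv_le_0_compat; auto. apply Rmult_le_pos; [apply pow_le|]; lra. }
    assert (D1 : C1 / N ^ (2 * k) <= C1 * wi ^ 1 / N ^ p)
      by (apply pow_shift_le; [lra|split; lra]).
    assert (D2 : C2 / N ^ (2 * k - 1) <= C2 * wi ^ 2 / N ^ p).
    { replace p with (2 * k - 1 + 2)%nat by lia. apply pow_shift_le; [lra|split; lra]. }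
    assert (D3 : C3 * wj / N ^ S (2 * k - 1) <= C3 * wj * wi ^ 1 / N ^ p).
    { replace p with (S (2 * k - 1) + 1)%nat by lia. apply pow_shift_le; [nra|split; lra]. }
    assert (D4 : C4 * wj / N ^ S (2 * k - 2) <= C4 * wj * wi ^ 2 / N ^ p).
    { replace p with (S (2 * k - 2) + 2)%nat by lia. apply pow_shift_le; [nra|split; lra]. }
    apply (Rmult_le_compat_l (wi * wj / 2)) in D1; [|lra].
    apply (Rmult_le_compat_l (wj / 2)) in D2; [|lra].
    apply (Rmult_le_compat_l (wi / 2)) in D3; [|lra].
    replace (wi * wj / 2 * (C1 * wi ^ 1 / N ^ p)) with (C1 * T / 2) in D1
      by (unfold T; field; lra).
    replace (wj / 2 * (C2 * wi ^ 2 / N ^ p)) with (C2 * T / 2) in D2 by (unfold T; field; lra).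
    replace (wi / 2 * (C3 * wj * wi ^ 1 / N ^ p)) with (C3 * T / 2) in D3
      by (unfold T; field; lra).
    replace (C4 * wj * wi ^ 2 / N ^ p) with (C4 * T) in D4 by (unfold T; field; lra).
    replace ((C0 + C1 + C2 + C3 + C4) * (wi ^ 2 * wj) / N ^ p) with
      ((C0 + C1 + C2 + C3 + C4) * T) by (unfold T; field; lra).
    assert (0 <= C0 * T) by nra. assert (0 <= C1 * T) by nra. assert (0 <= C2 * T) by nra.
    assert (0 <= C3 * T) by nra. assert (0 <= C4 * T) by nra. lra.
Qed.

(** * The eigenfunctions in closed form *)

(** The coefficients of [2F1(-n, n + 3; 3/2; t)], written as in [jacobi]. *)
Definition hyper_coef (n k : nat) : R :=
  pochhammer (- INR n) k * pochhammer (INR n + 1 / 2 + 3 / 2 + 1) k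
    / (pochhammer (1 / 2 + 1) k * INR (fact k)).

Lemma pochhammer_pos a k : 0 < a -> 0 < pochhammer a k.
Proof.
  intros Ha. induction k as [|k IH]; simpl; [lra|].
  pose proof (pos_INR k). apply Rmult_lt_0_compat; lra.
Qed.

Lemma hyper_coef_succ n k :
  hyper_coef n (S k) * (INR k + 1) * (INR k + 3 / 2)
  = hyper_coef n k * (INR k - INR n) * (INR k + INR n + 3).
Proof.
  unfold hyper_coef. change (fact (S k)) with (S k * fact k)%nat.
  rewrite mult_INR, S_INR. simpl pochhammer.
  pose proof (pochhammer_pos (1 / 2 + 1) k ltac:(lra)). pose proof (INR_fact_lt_0 k).
  pose proof (pos_INR k). field. repeat split; lra.
Qed.

(** Truncated at degree [N], so that the differential equation can be proved by
    induction on the truncation; [hyper1] and [hyper2] are its derivatives. *)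
Fixpoint hyper (n N : nat) (t : R) : R :=
  match N with
  | O => 1
  | S N' => hyper n N' t + hyper_coef n (S N') * t ^ S N'
  end.
Fixpoint hyper1 (n N : nat) (t : R) : R :=
  match N with
  | O => 0
  | S N' => hyper1 n N' t + hyper_coef n (S N') * (INR (S N') * t ^ N')
  end.
Fixpoint hyper2 (n N : nat) (t : R) : R :=
  match N with
  | O => 0
  | S N' => hyper2 n N' t + hyper_coef n (S N') * (INR (S N') * (INR N' * t ^ pred N'))
  end.

Lemma is_derive_hyper n N t : is_derive (hyper n N) t (hyper1 n N t).
Proof.
  induction N as [|N IH]; simpl hyper; cbn [hyper1].
  - apply (is_derive_const (K := R_AbsRing) (V := R_NormedModule) 1 t).
  - apply (is_derive_plus (hyper n N)); auto.
    apply (is_derive_scal (fun t => t * t ^ N)). evar_last.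
    apply (is_derive_pow (fun t => t) (S N) t 1). apply (is_derive_id (K := R_AbsRing)).
    cbn [pred]. ring.
Qed.
Lemma is_derive_hyper1 n N t : is_derive (hyper1 n N) t (hyper2 n N t).
Proof.
  induction N as [|N IH]; cbn [hyper1 hyper2].
  - apply (is_derive_const (K := R_AbsRing) (V := R_NormedModule) 0 t).
  - apply (is_derive_plus (hyper1 n N)); auto.
    apply (is_derive_scal (fun t => INR (S N) * t ^ N)).
    apply (is_derive_scal (fun t => t ^ N)). evar_last.
    apply (is_derive_pow (fun t => t) N t 1). apply (is_derive_id (K := R_AbsRing)).
    ring.
Qed.

(** For a partial sum the hypergeometric equation holds up to the first missing
    term; that term vanishes for [N = n]. *)
Lemma hyper_ode_partial n N t :
  t * (1 - t) * hyper2 n N t + (3 / 2 - 4 * t) * hyper1 n N t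
    + INR n * (INR n + 3) * hyper n N t
  = - hyper_coef n N * (INR N - INR n) * (INR N + INR n + 3) * t ^ N.
Proof.
  induction N as [|N IH].
  - simpl. unfold hyper_coef. simpl. field.
  - cbn [hyper hyper1 hyper2].
    assert (E : t * (INR N * t ^ pred N) = INR N * t ^ N) by (destruct N; simpl; ring).
    match goal with |- ?l = ?r => replace l with
      ((t * (1 - t) * hyper2 n N t + (3 / 2 - 4 * t) * hyper1 n N t
        + INR n * (INR n + 3) * hyper n N t)
       + hyper_coef n (S N) * (INR (S N) * (1 - t) * (t * (INR N * t ^ pred N))
          + (3 / 2 - 4 * t) * INR (S N) * t ^ N + INR n * (INR n + 3) * t ^ S N)) by ring end.
    rewrite IH, E.
    replace (- hyper_coef n N * (INR N - INR n) * (INR N + INR n + 3) * t ^ N)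
      with (- (hyper_coef n N * (INR N - INR n) * (INR N + INR n + 3)) * t ^ N) by ring.
    rewrite <- hyper_coef_succ, !S_INR. simpl. field.
Qed.

Lemma hyper_0 n N : hyper n N 0 = 1.
Proof. induction N as [|N IH]; cbn [hyper]; auto. rewrite IH, pow_i by lia. ring. Qed.

Lemma jacobi_hyper n x :
  jacobi n (1 / 2) (3 / 2) (cos (2 * x))
  = pochhammer (1 / 2 + 1) n / INR (fact n) * hyper n n (sin x ^ 2).
Proof.
  unfold jacobi. f_equal.
  assert (E : (1 - cos (2 * x)) / 2 = sin x ^ 2) by (rewrite cos_2a_sin; field).
  rewrite E. clear E. generalize n at 3 5 as N. induction N as [|N IH].
  - rewrite sum_O. simpl. field.
  - rewrite sum_Sn, IH. reflexivity.
Qed.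

(** The energy [D'^2 + w^2 D^2] has derivative [-4 D'^2 / (sin cos) <= 0] along
    solutions of [D'' + 2 D' / (sin cos) + w^2 D = 0]. It vanishes at [0], hence
    everywhere. *)
Lemma singular_ode_unique (D D1 : R -> R) (w : R) :
  w <> 0 ->
  (forall x, is_derive D x (D1 x)) -> continuous D1 0 -> D 0 = 0 -> D1 0 = 0 ->
  (forall x, 0 < x < PI / 2 ->
     is_derive D1 x (- (2 / (sin x * cos x)) * D1 x - w ^ 2 * D x)) ->
  forall x, 0 < x < PI / 2 -> D x = 0.
Proof.
  intros Hw HD HC H0 H10 HD1 x Hx.
  set (H := fun y => D1 y * D1 y + w ^ 2 * (D y * D y)).
  destruct (MVT_gen H 0 x (fun y => - 4 / (sin y * cos y) * (D1 y * D1 y))) as [y [Hy E]].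
  - intros y Hy. rewrite Rmin_left, Rmax_right in Hy by lra.
    assert (Hs : 0 < sin y) by (apply sin_pos_open; lra).
    assert (Hc : 0 < cos y) by (apply cos_pos_open; lra).
    unfold H. evar_last.
    + apply (is_derive_plus (fun y => D1 y * D1 y)).
      * apply (is_derive_mult D1 D1); [apply HD1; lra|apply HD1; lra|intros; apply Rmult_comm].
      * apply (is_derive_scal (fun y => D y * D y)).
        apply (is_derive_mult D D); [apply HD|apply HD|intros; apply Rmult_comm].
    + unfold plus, mult; simpl. field. lra.
  - intros y Hy. rewrite Rmin_left, Rmax_right in Hy by lra.
    apply continuity_pt_filterlim.
    assert (C1 : continuous D1 y).
    { destruct (Req_dec y 0) as [->|Hn]; auto.
      eapply continuous_of_is_derive, HD1. lra. }
    apply (continuous_plus (V := R_NormedModule) (fun y => D1 y * D1 y)).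
    + apply (continuous_mult D1 D1); auto.
    + apply (continuous_scal_r (V := R_NormedModule) (w ^ 2) (fun y => D y * D y)).
      apply (continuous_mult D D); eapply continuous_of_is_derive, HD.
  - rewrite Rmin_left, Rmax_right in Hy by lra.
    assert (HH : H x <= 0).
    { unfold H at 2 in E. rewrite H0, H10 in E. rewrite !Rmult_0_r, Rplus_0_r, Rminus_0_r in E.
      rewrite E. destruct (Req_dec y 0) as [->|Hn].
      - rewrite H10, !Rmult_0_r, Rmult_0_l. lra.
      - assert (Hs : 0 < sin y) by (apply sin_pos_open; lra).
        assert (Hc : 0 < cos y) by (apply cos_pos_open; lra).
        assert (0 < / (sin y * cos y)) by (apply Rinv_0_lt_compat, Rmult_lt_0_compat; auto).
        assert (0 <= D1 y * D1 y) by nra.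
        assert (0 <= / (sin y * cos y) * (D1 y * D1 y)) by (apply Rmult_le_pos; lra).
        unfold Rdiv. nra. }
    unfold H in HH. assert (0 < w ^ 2) by (simpl; nra). 
    assert (D x * D x <= 0) by nra. nra.
Qed.

(** The Dirichlet kernel [sin ((2k+1) x) / sin x] as a trigonometric sum, which makes
    the smoothness of [mode i x / sin x] at [0] evident. *)
Fixpoint dirichlet (k : nat) (x : R) : R :=
  match k with
  | O => 1
  | S k' => dirichlet k' x + 2 * cos (2 * INR k * x)
  end.
Fixpoint dirichlet' (k : nat) (x : R) : R :=
  match k with
  | O => 0
  | S k' => dirichlet' k' x + 2 * (- (2 * INR k) * sin (2 * INR k * x))
  end.

Lemma is_derive_dirichlet k x : is_derive (dirichlet k) x (dirichlet' k x).
Proof.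
  induction k as [|k IH]; cbn [dirichlet dirichlet'].
  - apply (is_derive_const (K := R_AbsRing) (V := R_NormedModule) 1 x).
  - apply (is_derive_plus (dirichlet k)); auto.
    apply (is_derive_scal (fun y => cos (2 * INR (S k) * y))). apply is_derive_cos_freq.
Qed.

Lemma continuous_dirichlet' k x : continuous (dirichlet' k) x.
Proof.
  induction k as [|k IH]; cbn [dirichlet'].
  - apply continuous_const.
  - apply (continuous_plus (V := R_NormedModule) (dirichlet' k)); auto.
    apply (continuous_scal_r (V := R_NormedModule) 2
      (fun y => - (2 * INR (S k)) * sin (2 * INR (S k) * y))).
    apply (continuous_scal_r (V := R_NormedModule) _ (fun y => sin (2 * INR (S k) * y))).
    apply continuous_sin_freq.
Qed.

Lemma sin_dirichlet k x : sin x * dirichlet k x = sin ((2 * INR k + 1) * x).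
Proof.
  induction k as [|k IH].
  - simpl. rewrite Rmult_1_r. f_equal. ring.
  - cbn [dirichlet]. rewrite Rmult_plus_distr_l, IH.
    replace ((2 * INR k + 1) * x) with (2 * INR (S k) * x - x) by (rewrite S_INR; ring).
    replace ((2 * INR (S k) + 1) * x) with (2 * INR (S k) * x + x) by ring.
    rewrite sin_minus, sin_plus. ring.
Qed.

Lemma dirichlet_0 k : dirichlet k 0 = 2 * INR k + 1.
Proof.
  induction k as [|k IH]; cbn [dirichlet]; [simpl; ring|].
  rewrite IH, Rmult_0_r, cos_0, S_INR. ring.
Qed.
Lemma dirichlet'_0 k : dirichlet' k 0 = 0.
Proof.
  induction k as [|k IH]; cbn [dirichlet']; auto.
  rewrite IH, Rmult_0_r, sin_0. ring.
Qed.

(** [mode i x / sin x] in a form without denominator. *)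
Definition mode_quotient (i : nat) (x : R) : R :=
  omega i * (cos x * dirichlet (S i) x) - cos (omega i * x).
Definition mode_quotient' (i : nat) (x : R) : R :=
  omega i * (- sin x * dirichlet (S i) x + cos x * dirichlet' (S i) x)
  + omega i * sin (omega i * x).

Lemma sin_mode_quotient i x : sin x * mode_quotient i x = mode i x.
Proof.
  unfold mode_quotient, mode.
  replace (omega i) with (2 * INR (S i) + 1) by (unfold omega; rewrite S_INR; ring).
  rewrite <- sin_dirichlet. ring.
Qed.

Lemma is_derive_mode_quotient i x : is_derive (mode_quotient i) x (mode_quotient' i x).
Proof.
  evar_last.
  - apply (is_derive_minus (fun x => omega i * (cos x * dirichlet (S i) x))).
    + apply (is_derive_scal (fun x => cos x * dirichlet (S i) x)).
      apply (is_derive_mult cos);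
        [apply is_derive_cos|apply is_derive_dirichlet|intros; apply Rmult_comm].
    + apply is_derive_cos_freq.
  - unfold mode_quotient', minus, plus, opp, mult; simpl. ring.
Qed.

Lemma is_derive_mode i x :
  is_derive (mode i) x ((omega i ^ 2 - 1) * cos x * cos (omega i * x)).
Proof. unfold mode. auto_derive; auto. ring. Qed.
Lemma is_derive_comode i x :
  is_derive (comode i) x (- (omega i ^ 2 - 1) * sin x * sin (omega i * x)).
Proof. unfold comode. auto_derive; auto. ring. Qed.

Lemma is_derive_mode_div_sin i x : sin x <> 0 ->
  is_derive (fun y => mode i y / sin y) x (omega i * cos x * comode i x / sin x ^ 2).
Proof.
  intros Hs. evar_last.
  - apply is_derive_div; [apply is_derive_mode|apply is_derive_sin|auto].
  - unfold mode, comode.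
    field. auto.
Qed.

Lemma interior_locally x : 0 < x < PI / 2 -> locally x (fun y => 0 < y < PI / 2).
Proof.
  intros Hx. apply (locally_interval _ x 0 (PI / 2)); simpl; try lra.
  intros y H1 H2; simpl in *; lra.
Qed.

Lemma mode_quotient_eq i x : sin x <> 0 -> mode_quotient i x = mode i x / sin x.
Proof. intros Hs. rewrite <- sin_mode_quotient. field. auto. Qed.

Lemma mode_quotient'_eq i x : 0 < x < PI / 2 ->
  mode_quotient' i x = omega i * cos x * comode i x / sin x ^ 2.
Proof.
  intros Hx.
  transitivity (Derive (mode_quotient i) x).
  { symmetry. apply is_derive_unique, is_derive_mode_quotient. }
  apply is_derive_unique.
  apply (is_derive_ext_loc (fun y => mode i y / sin y)).
  - apply (filter_imp _ _ (fun y Hy => eq_sym (mode_quotient_eq i y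
      (Rgt_not_eq _ _ (sin_pos_open y (conj (proj1 Hy) (Rlt_le _ _ (proj2 Hy)))))))).
    apply interior_locally; auto.
  - apply is_derive_mode_div_sin. apply Rgt_not_eq, sin_pos_open. lra.
Qed.

Lemma is_derive_mode_quotient' i x : 0 < x < PI / 2 ->
  is_derive (mode_quotient' i) x
    (- (2 / (sin x * cos x)) * mode_quotient' i x - omega i ^ 2 * mode_quotient i x).
Proof.
  intros Hx. assert (Hs : 0 < sin x) by (apply sin_pos_open; lra).
  assert (Hc : 0 < cos x) by (apply cos_pos_open; lra).
  apply (is_derive_ext_loc (fun y => omega i * cos y * comode i y / sin y ^ 2)).
  - apply (filter_imp (fun y => 0 < y < PI / 2)); [|apply interior_locally; auto].
    intros y Hy. symmetry. apply mode_quotient'_eq; auto.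
  - rewrite mode_quotient'_eq, mode_quotient_eq by (auto; lra).
    (* With this form of the coefficient the identity is one of rational functions. *)
    replace (2 / (sin x * cos x)) with (2 * (sin x ^ 2 + cos x ^ 2) / (sin x * cos x))
      by (rewrite cos_sq; field; lra).
    evar_last.
    + apply (is_derive_div (fun y => omega i * cos y * comode i y) (fun y => sin y ^ 2)).
      * apply (is_derive_mult (fun y => omega i * cos y)).
        apply is_derive_scal, is_derive_cos. apply is_derive_comode. intros; apply Rmult_comm.
      * apply is_derive_pow, is_derive_sin.
      * apply pow_nonzero; lra.
    + unfold comode, mode, plus, mult; simpl. field. lra.
Qed.

(** The factor that remains when the value at [0] is scaled out: the Jacobi
    polynomial has the value [(3/2)_i / i!] there, and [mode i x / sin x] tends to
    [omega_i^2 - 1]. *)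
Definition mode_coef (i : nat) : R :=
  2 * (sqrt (INR (fact i) * INR (fact (i + 2))) / Euler_Gamma (INR i + 3 / 2))
  * (pochhammer (1 / 2 + 1) i / INR (fact i)) / (omega i ^ 2 - 1).

Lemma omega_sq i : omega i ^ 2 - 1 = 4 * ((INR i + 1) * (INR i + 2)).
Proof. unfold omega. ring. Qed.

(** Both sides solve the eigenvalue equation, take the value [omega_i^2 - 1] at [0]
    and have derivative [0] there. *)
Lemma hyper_mode i x : 0 < x < PI / 2 ->
  (omega i ^ 2 - 1) * (cos x ^ 3 * hyper i i (sin x ^ 2)) = mode i x / sin x.
Proof.
  intros Hx. set (c := omega i ^ 2 - 1).
  assert (Hs : 0 < sin x) by (apply sin_pos_open; lra).
  rewrite <- mode_quotient_eq by lra.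
  set (h := fun y => hyper i i (sin y ^ 2)).
  set (h1 := fun y => hyper1 i i (sin y ^ 2)).
  set (h2 := fun y => hyper2 i i (sin y ^ 2)).
  assert (Dh : forall y, is_derive h y (2 * sin y * cos y * h1 y)).
  { intros y. evar_last.
    - apply (is_derive_comp (hyper i i) (fun z => sin z ^ 2)).
      apply is_derive_hyper. apply is_derive_pow, is_derive_sin.
    - unfold scal, h1; simpl; unfold mult; simpl. ring. }
  assert (Dh1 : forall y, is_derive h1 y (2 * sin y * cos y * h2 y)).
  { intros y. evar_last.
    - apply (is_derive_comp (hyper1 i i) (fun z => sin z ^ 2)).
      apply is_derive_hyper1. apply is_derive_pow, is_derive_sin.
    - unfold scal, h2; simpl; unfold mult; simpl. ring. }
  set (E1 := fun y => - 3 * sin y * cos y ^ 2 * h y + 2 * sin y * cos y ^ 4 * h1 y).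
  assert (DE : forall y, is_derive (fun z => cos z ^ 3 * h z) y (E1 y)).
  { intros y. evar_last.
    - apply (is_derive_mult (fun z => cos z ^ 3)).
      apply is_derive_cos_pow. apply Dh. intros; apply Rmult_comm.
    - unfold E1, plus, mult; simpl. ring. }
  assert (DE1 : forall y, is_derive E1 y
    ((6 * sin y ^ 2 * cos y - 3 * cos y ^ 3) * h y
     + (- 6 * sin y ^ 2 * cos y ^ 3 + 2 * cos y ^ 5 - 8 * sin y ^ 2 * cos y ^ 3) * h1 y
     + 4 * sin y ^ 2 * cos y ^ 5 * h2 y)).
  { intros y. evar_last.
    - apply (is_derive_plus (fun z => - 3 * sin z * cos z ^ 2 * h z)).
      + apply (is_derive_mult (fun z => - 3 * sin z * cos z ^ 2)).
        * apply (is_derive_mult (fun z => - 3 * sin z)).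
          apply is_derive_scal, is_derive_sin. apply is_derive_cos_pow.
          intros; apply Rmult_comm.
        * apply Dh.
        * intros; apply Rmult_comm.
      + apply (is_derive_mult (fun z => 2 * sin z * cos z ^ 4)).
        * apply (is_derive_mult (fun z => 2 * sin z)).
          apply is_derive_scal, is_derive_sin. apply is_derive_cos_pow.
          intros; apply Rmult_comm.
        * apply Dh1.
        * intros; apply Rmult_comm.
    - unfold plus, mult; simpl. ring. }
  apply Rminus_diag_uniq.
  apply (singular_ode_unique
    (fun y => c * (cos y ^ 3 * h y) - mode_quotient i y)
    (fun y => c * E1 y - mode_quotient' i y) (omega i)).
  - pose proof (omega_ge_3 i). lra.
  - intros y. apply (is_derive_minus (fun y => c * (cos y ^ 3 * h y))).
    apply (is_derive_scal (fun y => cos y ^ 3 * h y)), DE. apply is_derive_mode_quotient.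
  - apply (continuous_minus (V := R_NormedModule) (fun y => c * E1 y)).
    + apply (continuous_scal_r (V := R_NormedModule) c E1).
      eapply continuous_of_is_derive, DE1.
    + unfold mode_quotient'.
      apply (continuous_plus (V := R_NormedModule)).
      * apply (continuous_scal_r (V := R_NormedModule) (omega i)
          (fun x => - sin x * dirichlet (S i) x + cos x * dirichlet' (S i) x)).
        apply (continuous_plus (V := R_NormedModule)).
        apply (continuous_mult (fun x => - sin x)).
        apply (continuous_opp (V := R_NormedModule)), continuous_sin.
        eapply continuous_of_is_derive, is_derive_dirichlet.
        apply (continuous_mult cos). apply continuous_cos. apply continuous_dirichlet'.
      * apply (continuous_scal_r (V := R_NormedModule) (omega i) (fun x => sin (omega i * x))).
        apply continuous_sin_freq.
  - unfold h, c, mode_quotient.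
    rewrite cos_0, sin_0, pow_i, hyper_0, dirichlet_0, Rmult_0_r, cos_0 by lia.
    unfold omega. rewrite S_INR. ring.
  - unfold E1, mode_quotient'. rewrite sin_0, dirichlet'_0, (Rmult_0_r (omega i)), sin_0. ring.
  - intros y Hy. evar_last.
    + apply (is_derive_minus (fun y => c * E1 y)).
      apply (is_derive_scal E1), DE1. apply is_derive_mode_quotient'; auto.
    + assert (Hsy : 0 < sin y) by (apply sin_pos_open; lra).
      assert (Hcy : 0 < cos y) by (apply cos_pos_open; lra).
      pose proof (hyper_ode_partial i i (sin y ^ 2)) as O.
      rewrite Rminus_diag, Rmult_0_r, !Rmult_0_l in O.
      fold (h y) in O. fold (h1 y) in O. fold (h2 y) in O.
      assert (O' : 4 * (sin y ^ 2 * (1 - sin y ^ 2) * h2 y) =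
        - 4 * ((3 / 2 - 4 * sin y ^ 2) * h1 y + INR i * (INR i + 3) * h y)) by lra.
      unfold minus, plus, opp; simpl plus. cbv beta.
      replace (4 * sin y ^ 2 * cos y ^ 5 * h2 y) with
        (cos y ^ 3 * (4 * (sin y ^ 2 * (1 - sin y ^ 2) * h2 y)))
        by (rewrite <- cos_sq; ring).
      rewrite O'. unfold E1.
      replace (sin y ^ 2) with (1 - cos y ^ 2) by (rewrite cos_sq; ring).
      unfold omega. simpl. field. lra.
  - auto.
Qed.

Lemma sin_e i x : 0 < x < PI / 2 -> sin x * e i x = mode_coef i * mode i x.
Proof.
  intros Hx. pose proof (sin_pos_open x ltac:(lra)). pose proof (hyper_mode i x Hx) as E.
  unfold e, mode_coef. rewrite jacobi_hyper.
  pose proof (omega_ge_3 i).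
  apply (Rmult_eq_compat_l (sin x)) in E.
  replace (sin x * (mode i x / sin x)) with (mode i x) in E by (field; lra).
  rewrite <- E. unfold Rdiv. 
  set (A := sqrt _). set (B := / Euler_Gamma _). set (C := / INR (fact i)).
  field. nra.
Qed.

(** * The normalization of the eigenfunctions *)

Definition is_Gamma (z l : R) : Prop :=
  is_RInt_gen (fun t => Rpower t (z - 1) * exp (- t)) (at_right 0) (Rbar_locally p_infty) l.

Lemma is_Gamma_unique z l : is_Gamma z l -> Euler_Gamma z = l.
Proof.
  intros H.
  exact (@is_RInt_gen_unique R_CompleteNormedModule (at_right 0) (Rbar_locally p_infty)
           _ _ (fun t => Rpower t (z - 1) * exp (- t)) l H).
Qed.

Lemma filter_prod_positive (P : R * R -> Prop) :
  (forall a b, 0 < a -> 0 < b -> P (a, b)) ->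
  filter_prod (at_right 0) (Rbar_locally p_infty) P.
Proof.
  intros H. apply (Filter_prod _ _ _ (fun a => 0 < a) (fun b => 0 < b)).
  - exists (mkposreal 1 Rlt_0_1). intros y _ Hy. exact Hy.
  - exists 0. auto.
  - exact H.
Qed.

(** From [ln u <= u] with [u = t / (2z)]. *)
Lemma Rpower_exp_le z t : 0 < z -> 0 < t ->
  Rpower t z * exp (- t) <= exp (z * ln (2 * z)) * exp (- (t / 2)).
Proof.
  intros Hz Ht. unfold Rpower. rewrite <- !exp_plus.
  assert (H : ln t <= ln (2 * z) + t / (2 * z)).
  { replace t with (2 * z * (t / (2 * z))) at 1 by (field; lra).
    assert (0 < t / (2 * z)) by (apply Rdiv_lt_0_compat; lra).
    rewrite ln_mult by lra. apply Rplus_le_compat_l.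
    apply Rlt_le. rewrite <- (ln_exp (t / (2 * z))) at 2. apply ln_increasing; auto.
    pose proof (exp_ineq1 (t / (2 * z)) ltac:(lra)). lra. }
  apply (Rmult_le_compat_l z) in H; [|lra].
  replace (z * (ln (2 * z) + t / (2 * z))) with (z * ln (2 * z) + t / 2) in H by (field; lra).
  assert (exp_le : forall a b, a <= b -> exp a <= exp b).
  { intros a b [Hab| -> ]; [left; apply exp_increasing; auto|right; auto]. }
  apply exp_le. lra.
Qed.

Lemma exp_opp_half_small (c eps : R) : 0 < c -> 0 < eps ->
  exists M, forall t, M < t -> c * exp (- (t / 2)) < eps.
Proof.
  intros Hc He.
  (* Solves [c * exp (- (t / 2)) = eps]. *)
  exists (- (2 * ln (eps / c))). intros t Ht.
  assert (Hp : 0 < eps / c) by (apply Rdiv_lt_0_compat; auto).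
  replace eps with (c * (eps / c)) by (field; lra).
  apply Rmult_lt_compat_l; auto.
  rewrite <- (exp_ln (eps / c)) by auto. apply exp_increasing. lra.
Qed.

Lemma is_derive_Rpower_exp z t : 0 < t ->
  is_derive (fun t => Rpower t z * exp (- t)) t
    (z * (Rpower t (z - 1) * exp (- t)) - Rpower t z * exp (- t)).
Proof.
  intros Ht. unfold Rpower.
  replace ((z - 1) * ln t) with (z * ln t + - ln t) by ring.
  rewrite exp_plus, exp_Ropp, exp_ln by auto.
  auto_derive; auto. field. lra.
Qed.

Lemma continuous_Rpower_exp z t : 0 < t -> continuous (fun t => Rpower t z * exp (- t)) t.
Proof. intros Ht. eapply continuous_of_is_derive, is_derive_Rpower_exp, Ht. Qed.

(** Integration by parts: [t^z e^(-t)] vanishes at both ends of the half-line. The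
    existence of the integral is carried along, so convergence has to be proved
    directly only for the starting value. *)
Lemma is_Gamma_succ z l : 0 < z -> is_Gamma z l -> is_Gamma (z + 1) (z * l).
Proof.
  intros Hz Hl. set (h := fun t => Rpower t z * exp (- t)).
  assert (HD : forall a b x, 0 < a -> 0 < b -> Rmin a b <= x -> 0 < x).
  { intros a b x Ha Hb Hx. pose proof (Rmin_pos a b Ha Hb). lra. }
  assert (Hh : is_RInt_gen (Derive h) (at_right 0) (Rbar_locally p_infty) (0 - 0)).
  { apply is_RInt_gen_Derive.
    - apply filter_prod_positive. intros a b Ha Hb x [Hx _]; simpl in Hx.
      eexists. apply is_derive_Rpower_exp. eauto.
    - apply filter_prod_positive. intros a b Ha Hb x [Hx _]; simpl in Hx.
      assert (Hx0 : 0 < x) by eauto.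
      apply (continuous_ext_loc _
        (fun t => z * (Rpower t (z - 1) * exp (- t)) - Rpower t z * exp (- t))).
      + apply (locally_interval _ x 0 p_infty); simpl; auto. intros y Hy _. simpl in Hy.
        symmetry. apply is_derive_unique, is_derive_Rpower_exp, Hy.
      + apply (continuous_minus (V := R_NormedModule)
          (fun t => z * (Rpower t (z - 1) * exp (- t)))).
        * apply (continuous_scal_r (V := R_NormedModule) z
            (fun t => Rpower t (z - 1) * exp (- t))).
          apply continuous_Rpower_exp; auto.
        * apply continuous_Rpower_exp; auto.
    - intros P [eps He].
      (* Near [0] the factor [t^z] is below [eps] as soon as [t < eps^(1/z)]. *)
      assert (Hd : 0 < Rpower eps (/ z)) by apply exp_pos.
      exists (mkposreal _ Hd). intros y Hy Hy0. apply He.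
      change (Rabs (y - 0) < Rpower eps (/ z)) in Hy. change (Rabs (h y - 0) < eps).
      rewrite Rminus_0_r in *. rewrite Rabs_pos_eq in Hy by lra.
      assert (H1 : 0 < Rpower y z) by apply exp_pos.
      assert (H2 : 0 < exp (- y) < 1).
      { split; [apply exp_pos|]. rewrite <- exp_0. apply exp_increasing. lra. }
      assert (H3 : Rpower y z < eps).
      { replace (pos eps) with (Rpower (Rpower eps (/ z)) z).
        - apply Rlt_Rpower_l; lra.
        - rewrite Rpower_mult, Rinv_l, Rpower_1 by (try apply cond_pos; lra). auto. }
      unfold h. rewrite Rabs_pos_eq by nra. nra.
    - intros P [eps He].
      destruct (exp_opp_half_small (exp (z * ln (2 * z))) eps (exp_pos _) (cond_pos eps)) as
        [M HM].
      exists (Rmax 0 M). intros y Hy. apply He.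
      change (Rabs (h y - 0) < eps). rewrite Rminus_0_r.
      pose proof (Rmax_l 0 M). pose proof (Rmax_r 0 M).
      assert (0 < h y) by (apply Rmult_lt_0_compat; apply exp_pos).
      rewrite Rabs_pos_eq by lra.
      eapply Rle_lt_trans; [apply Rpower_exp_le; lra|]. apply HM. lra. }
  apply (is_RInt_gen_scal (V := R_NormedModule) _ z) in Hl.
  pose proof (is_RInt_gen_minus (V := R_NormedModule) _ _ _ _ Hl Hh) as H.
  unfold is_Gamma. replace (z * l) with (minus (scal z l) (0 - 0)).
  2: { unfold minus, plus, opp, scal; simpl; unfold mult; simpl. ring. }
  eapply is_RInt_gen_ext; [|exact H].
  apply filter_prod_positive. intros a b Ha Hb x [Hx _]; simpl in Hx.
  assert (Hx0 : 0 < x) by (eapply HD; [exact Ha|exact Hb|lra]).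
  rewrite (is_derive_unique h x _ (is_derive_Rpower_exp z x Hx0)).
  unfold minus, plus, opp, scal; simpl; unfold mult; simpl.
  replace (z + 1 - 1) with z by ring. ring.
Qed.

(** The primitive of [sqrt t e^(-t)] is increasing, and it is bounded because
    [sqrt t <= e^(t/2)]; its limit is the integral. *)
Lemma is_Gamma_three_halves : exists l, 0 < l /\ is_Gamma (3 / 2) l.
Proof.
  set (phi := fun t => sqrt t * exp (- t)).
  assert (Cphi : forall t, continuous phi t).
  { intros t. apply (continuous_mult sqrt). apply continuous_sqrt.
    apply (continuous_comp Ropp exp).
    apply (continuous_opp (V := R_NormedModule) (fun x => x)), continuous_id.
    apply continuous_exp. }
  set (Phi := fun b => RInt phi 0 b).
  assert (DPhi : forall b, is_derive Phi b (phi b))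
    by (intros; apply is_derive_primitive; auto).
  assert (CPhi : forall b, continuity_pt Phi b).
  { intros b. apply continuity_pt_filterlim. eapply continuous_of_is_derive, DPhi. }
  assert (Phi0 : Phi 0 = 0) by apply (RInt_point (V := R_CompleteNormedModule)).
  assert (Hmono : forall a b, a <= b -> Phi a <= Phi b).
  { intros a b Hab. destruct (MVT_gen Phi a b phi) as [c [_ E]]; auto.
    assert (0 <= phi c) by (apply Rmult_le_pos; [apply sqrt_pos|left; apply exp_pos]). nra. }
  assert (Hphi : forall t, phi t <= exp (- (t / 2))).
  { intros t. unfold phi. replace (- t) with (- (t / 2) + - (t / 2)) by field.
    rewrite exp_plus. set (E := exp (- (t / 2))). assert (0 < E) by apply exp_pos.
    assert (sqrt t * E <= 1).
    { destruct (Rle_dec t 0) as [Hn|Hp].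
      - rewrite sqrt_neg_0 by auto. lra.
      - assert (sqrt t <= exp (t / 2)).
        { rewrite <- (sqrt_pow2 (exp (t / 2))) by (left; apply exp_pos).
          apply sqrt_le_1_alt. simpl. rewrite Rmult_1_r, <- exp_plus.
          replace (t / 2 + t / 2) with t by field.
          pose proof (exp_ineq1 t ltac:(lra)). lra. }
        apply Rle_trans with (exp (t / 2) * E). apply Rmult_le_compat_r; lra.
        unfold E. rewrite <- exp_plus. replace (t / 2 + - (t / 2)) with 0 by ring.
        rewrite exp_0. lra. }
    nra. }
  assert (Hbound : forall b, 0 <= b -> Phi b <= 2).
  { intros b Hb.
    (* The integrand is at most [exp (- (t / 2))], so this function is
       nonincreasing, and it equals [2] at [0]. *)
    destruct (MVT_gen (fun t => Phi t + 2 * exp (- (t / 2))) 0 b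
      (fun t => phi t - exp (- (t / 2)))) as [c [_ E]].
    - intros t _. apply (is_derive_plus Phi); auto. auto_derive; auto. unfold Rdiv.
      change (2 * (- (1 * / 2) * exp (- (t * / 2))) = - exp (- (t * / 2))). field.
    - intros t _. apply continuity_pt_plus; auto. apply continuity_pt_filterlim.
      apply (@ex_derive_continuous R_AbsRing R_NormedModule (fun t => 2 * exp (- (t / 2)))).
      auto_derive. auto.
    - rewrite Phi0 in E. replace (0 / 2) with 0 in E by field. rewrite Ropp_0, exp_0 in E.
      specialize (Hphi c). pose proof (exp_pos (- (b / 2))). nra. }
  destruct (completeness (fun y => exists b, 0 <= b /\ y = Phi b)) as [l [Hub Hlub]].
  { exists 2. intros y [b [Hb ->]]. auto. }
  { exists (Phi 0), 0. split; auto. lra. }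
  exists l. split.
  - apply Rlt_le_trans with (Phi 1); [|apply Hub; exists 1; split; auto; lra].
    apply RInt_gt_0; [lra| |auto].
    intros t Ht. apply Rmult_lt_0_compat; [apply sqrt_lt_R0; lra|apply exp_pos].
  - unfold is_Gamma. rewrite <- (Rminus_0_r l).
    apply (is_RInt_gen_ext (V := R_NormedModule) (Derive Phi)).
    { apply filter_prod_positive. intros a b Ha Hb x [Hx _]; simpl in Hx.
      assert (Hx0 : 0 < x) by (pose proof (Rmin_pos a b Ha Hb); lra).
      rewrite (is_derive_unique _ _ _ (DPhi x)). unfold phi.
      replace (3 / 2 - 1) with (/ 2) by field. rewrite Rpower_sqrt; auto. }
    apply is_RInt_gen_Derive.
    + apply filter_prod_positive. intros a b Ha Hb x _. eexists; apply DPhi.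
    + apply filter_prod_positive. intros a b Ha Hb x _.
      apply (continuous_ext phi); auto. intros y. symmetry. apply is_derive_unique, DPhi.
    + assert (H0 : filterlim Phi (at_right 0) (locally (Phi 0))).
      { intros P HP.
        destruct (proj1 (continuity_pt_filterlim _ _) (CPhi 0) P HP) as [d Hd].
        exists d. intros y Hy _. apply Hd, Hy. }
      rewrite Phi0 in H0. exact H0.
    + intros P [eps He].
      assert (exists b, 0 <= b /\ l - eps < Phi b) as [b [Hb Hlt]].
      { apply Classical_Prop.NNPP. intros Hno.
        assert (l <= l - eps); [|pose proof (cond_pos eps); lra].
        apply Hlub. intros y [b [Hb ->]]. apply Rnot_lt_le. intros H. apply Hno. eauto. }
      exists b. intros y Hy. apply He. change (Rabs (Phi y - l) < eps).
      assert (Phi b <= Phi y) by (apply Hmono; lra).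
      assert (Phi y <= l) by (apply Hub; exists y; split; auto; lra).
      pose proof (cond_pos eps). apply Rabs_def1; lra.
Qed.

Lemma Euler_Gamma_three_halves_pos : 0 < Euler_Gamma (3 / 2).
Proof.
  destruct is_Gamma_three_halves as [l [Hl H]]. rewrite (is_Gamma_unique _ _ H). auto.
Qed.

Lemma Euler_Gamma_shift i :
  Euler_Gamma (INR i + 3 / 2) = pochhammer (1 / 2 + 1) i * Euler_Gamma (3 / 2).
Proof.
  destruct is_Gamma_three_halves as [l [Hl H]]. rewrite (is_Gamma_unique _ _ H).
  apply is_Gamma_unique. induction i as [|i IH].
  - simpl. replace (0 + 3 / 2) with (3 / 2) by ring. rewrite Rmult_1_l. auto.
  - rewrite S_INR. replace (INR i + 1 + 3 / 2) with (INR i + 3 / 2 + 1) by ring.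
    cbn [pochhammer].
    replace (pochhammer (1 / 2 + 1) i * (1 / 2 + 1 + INR i) * l) with
      ((INR i + 3 / 2) * (pochhammer (1 / 2 + 1) i * l)) by field.
    apply is_Gamma_succ; auto. pose proof (pos_INR i). lra.
Qed.

(** The factorials and the Gamma factor cancel because
    [omega_i^2 - 1 = 4 (i + 1) (i + 2)]. *)
Lemma mode_coef_eq i :
  mode_coef i = / (Euler_Gamma (3 / 2) * sqrt (omega i ^ 2 - 1)).
Proof.
  unfold mode_coef. rewrite Euler_Gamma_shift, omega_sq.
  pose proof Euler_Gamma_three_halves_pos. pose proof (pochhammer_pos (1 / 2 + 1) i ltac:(lra)).
  pose proof (INR_fact_lt_0 i) as Hf. pose proof (pos_INR i).
  set (q := (INR i + 1) * (INR i + 2)). assert (Hq : 0 < q) by (unfold q; nra).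
  assert (Hs : 0 < sqrt q) by (apply sqrt_lt_R0; auto).
  replace (INR (fact i) * INR (fact (i + 2))) with (INR (fact i) ^ 2 * q).
  2: { rewrite Nat.add_comm. change (fact (2 + i)) with (S (S i) * (S i * fact i))%nat.
       rewrite !mult_INR, !S_INR. unfold q. ring. }
  rewrite sqrt_mult, sqrt_pow2 by (try apply pow2_ge_0; lra).
  replace (4 * q) with (2 ^ 2 * q) by ring.
  rewrite (sqrt_mult (2 ^ 2)), sqrt_pow2 by lra.
  assert (E : sqrt q * sqrt q = q) by (rewrite sqrt_sqrt; lra).
  set (s := sqrt q) in *. clearbody s. rewrite <- E. field. repeat split; lra.
Qed.

Lemma mode_coef_pos i : 0 < mode_coef i.
Proof.
  rewrite mode_coef_eq. apply Rinv_0_lt_compat, Rmult_lt_0_compat.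
  apply Euler_Gamma_three_halves_pos. apply sqrt_lt_R0.
  pose proof (omega_ge_3 i). nra.
Qed.

Lemma mode_coef_le : exists C, 0 < C /\ forall i, mode_coef i * omega i <= C.
Proof.
  pose proof Euler_Gamma_three_halves_pos as HG. set (G := Euler_Gamma (3 / 2)) in *.
  exists (2 / G). split. apply Rdiv_lt_0_compat; lra.
  intros i. rewrite mode_coef_eq. fold G. pose proof (omega_ge_3 i).
  assert (omega i / 2 <= sqrt (omega i ^ 2 - 1)).
  { rewrite <- (sqrt_pow2 (omega i / 2)) by lra. apply sqrt_le_1_alt. nra. }
  set (s := sqrt _) in *.
  apply (Rmult_le_reg_r (G * s)); [apply Rmult_lt_0_compat; lra|].
  replace (/ (G * s) * omega i * (G * s)) with (omega i) by (field; lra).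
  replace (2 / G * (G * s)) with (2 * s) by (field; lra). lra.
Qed.

(** * Decay of the Fourier constants *)

Lemma e_mode i x : 0 < x < PI / 2 -> e i x = mode_coef i * (mode i x / sin x).
Proof.
  intros Hx. pose proof (sin_pos_open x ltac:(lra)).
  apply (Rmult_eq_reg_l (sin x)); [|lra]. rewrite sin_e by auto. field. lra.
Qed.

Lemma e'_comode i x : 0 < x < PI / 2 ->
  e' i x = mode_coef i * (omega i * cos x * comode i x / sin x ^ 2).
Proof.
  intros Hx. apply is_derive_unique.
  apply (is_derive_ext_loc (fun y => mode_coef i * (mode i y / sin y))).
  - apply (filter_imp (fun y => 0 < y < PI / 2)); [|apply interior_locally; auto].
    intros y Hy. symmetry. apply e_mode; auto.
  - apply (is_derive_scal (fun y => mode i y / sin y)).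
    apply is_derive_mode_div_sin. apply Rgt_not_eq, sin_pos_open. lra.
Qed.

(** From [(omega_i^2 - 4) g_i = sin cos e_i' + (1 + 2 sin^2) e_i]. The derivative of
    the right-hand side is [- (omega_i^2 - 4) sin cos e_i] by the eigenvalue
    equation, and both sides vanish at [PI / 2]. *)
Lemma g_modes i x : 0 < x < PI / 2 ->
  g i x = mode_coef i / (omega i ^ 2 - 4)
    * ((omega i * cos x ^ 2 * comode i x + (1 + 2 * sin x ^ 2) * mode i x) / sin x).
Proof.
  intros Hx. unfold g. pose proof (omega_ge_3 i) as Hw.
  assert (Hw4 : 0 < omega i ^ 2 - 4) by nra.
  set (k := mode_coef i / (omega i ^ 2 - 4)).
  set (G := fun y => - (k *
      ((omega i * cos y ^ 2 * comode i y + (1 + 2 * sin y ^ 2) * mode i y) / sin y))).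
  assert (E : RInt (fun y => mode_coef i * cos y * mode i y) x (PI / 2) = G (PI / 2) - G x).
  { apply is_RInt_unique. apply (is_RInt_derive G).
    - intros y Hy. rewrite Rmin_left, Rmax_right in Hy by lra.
      assert (Hs : 0 < sin y) by (apply sin_pos_open; lra).
      unfold G. evar_last.
      + apply (is_derive_opp (V := R_NormedModule)).
        apply (is_derive_scal (fun y => _ / sin y)).
        apply is_derive_div; [|apply is_derive_sin|lra].
        apply (is_derive_plus (fun y => omega i * cos y ^ 2 * comode i y)).
        * apply (is_derive_mult (fun y => omega i * cos y ^ 2));
            [|apply is_derive_comode|intros; apply Rmult_comm].
          apply (is_derive_scal (fun y => cos y ^ 2)), is_derive_cos_pow.
        * apply (is_derive_mult (fun y => 1 + 2 * sin y ^ 2));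
            [|apply is_derive_mode|intros; apply Rmult_comm].
          apply (is_derive_plus (fun y => 1)).
          apply (is_derive_const (K := R_AbsRing) (V := R_NormedModule) 1).
          apply (is_derive_scal (fun y => sin y ^ 2)), is_derive_pow, is_derive_sin.
      + unfold opp, plus, mult, zero; simpl Ropp; cbn -[pow INR omega].
        replace (mode_coef i) with (k * (omega i ^ 2 - 4)) by (unfold k; field; lra).
        (* The added term is a multiple of [cos^2 + sin^2 - 1], chosen so that
           the first equality is rational. *)
        transitivity (k * (omega i ^ 2 - 4) * cos y * mode i y
          + k * omega i * cos y * comode i y * (cos y ^ 2 + sin y ^ 2 - 1) / sin y ^ 2).
        * unfold mode, comode. simpl (INR 2). simpl Init.Nat.pred. field. lra.
        * rewrite cos_sq. field. lra.
    - intros y Hy. apply (continuous_mult (fun y => mode_coef i * cos y)).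
      apply (continuous_scal_r (V := R_NormedModule) (mode_coef i) cos), continuous_cos.
      apply continuous_mode. }
  transitivity (G (PI / 2) - G x).
  - rewrite <- E. apply RInt_ext. intros y Hy. rewrite Rmin_left, Rmax_right in Hy by lra.
    assert (Hs : 0 < sin y) by (apply sin_pos_open; lra).
    rewrite e_mode by lra.
    change (mode_coef i * (mode i y / sin y) * sin y * cos y = mode_coef i * cos y * mode i y).
    field. lra.
  - unfold G, mode at 1. rewrite cos_PI2, sin_PI2.
    assert (cos (omega i * (PI / 2)) = 0) as ->.
    { replace (omega i * (PI / 2)) with (INR (S i) * PI + PI / 2)
        by (unfold omega; rewrite S_INR; field).
      rewrite cos_plus, sin_nat_PI, cos_PI2. ring. }
    unfold Rdiv. ring.
Qed.

Lemma e_0_eq x : e 0 x = e 0 0 * cos x ^ 3.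
Proof.
  unfold e, jacobi. rewrite !sum_O. rewrite cos_0. simpl. ring.
Qed.

Lemma e'_0_eq x : e' 0 x = - 3 * e 0 0 * (cos x ^ 2 * sin x).
Proof.
  apply is_derive_unique.
  apply (is_derive_ext (fun x => e 0 0 * cos x ^ 3)).
  { intros t. symmetry. apply e_0_eq. }
  evar_last. apply (is_derive_scal (fun x => cos x ^ 3)), is_derive_cos_pow.
  simpl. ring.
Qed.

Lemma e_0_0_neq_0 : e 0 0 <> 0.
Proof.
  unfold e, jacobi. rewrite sum_O, Euler_Gamma_shift, cos_0.
  pose proof Euler_Gamma_three_halves_pos.
  apply Rgt_not_eq. simpl.
  replace (1 * 1 / (1 * 1) * 1) with 1 by field.
  repeat apply Rmult_lt_0_compat; try lra.
  - apply sqrt_lt_R0. lra.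
  - apply Rinv_0_lt_compat. lra.
Qed.

(** Values of [RInt] are typed in the carrier of a normed module, which [ring] and
    [field] do not recognize as [R]. *)
Ltac real_equation := match goal with |- ?a = ?b => change (@eq R a b) end.

Lemma mixed_kernel_integral (f : R -> R) (k : R) (w : trigpoly) (i j : nat) :
  (forall x, 0 < x < PI / 2 -> f x = k * (eval w x * mode j x * comode i x)) ->
  RInt f 0 (PI / 2) = k * mixed_kernel w i j.
Proof.
  intros Hf. unfold mixed_kernel. pose proof PI_RGT_0.
  rewrite <- (RInt_scal (V := R_CompleteNormedModule)).
  - apply RInt_ext. intros x Hx. rewrite Rmin_left, Rmax_right in Hx by lra. auto.
  - apply ex_RInt_quarter. intros x Hx.
    apply continuous_kernel_integrand; auto using continuous_mode, continuous_comode.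
Qed.

Lemma gap_decay_scal (p : nat) (b b' : nat -> nat -> R) (a : nat -> nat -> R) (D : R) K :
  0 <= D -> (forall i j, 0 <= b i j) ->
  (forall i j, Rabs (a i j) * b i j <= D * b' i j) ->
  gap_decay p b K -> gap_decay p b' (fun i j => a i j * K i j).
Proof.
  intros HD Hb Hab (C & HC & H). exists (C * D). split; [apply Rmult_le_pos; auto|].
  intros i j. destruct (H i j) as [H1 H2]. rewrite Rabs_mult.
  assert (E : Rabs (a i j) * (C * b i j) <= C * D * b' i j).
  { replace (Rabs (a i j) * (C * b i j)) with (C * (Rabs (a i j) * b i j)) by ring.
    rewrite Rmult_assoc. apply Rmult_le_compat_l; auto. }
  split.
  - eapply Rle_trans; [apply Rmult_le_compat_l, H1; apply Rabs_pos|exact E].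
  - intros Hlt. specialize (H2 Hlt).
    eapply Rle_trans; [apply Rmult_le_compat_l, H2; apply Rabs_pos|].
    unfold Rdiv. rewrite <- Rmult_assoc. apply Rmult_le_compat_r; auto.
    left. apply Rinv_0_lt_compat, pow_lt. unfold omega. apply lt_INR in Hlt. lra.
Qed.

Lemma gap_decay_plus p b K K' :
  gap_decay p b K -> gap_decay p b K' -> gap_decay p b (fun i j => K i j + K' i j).
Proof.
  intros (C & HC & H) (C' & HC' & H'). exists (C + C'). split; [lra|].
  intros i j. destruct (H i j) as [H1 H2]. destruct (H' i j) as [H1' H2'].
  split.
  - eapply Rle_trans; [apply Rabs_triang|]. lra.
  - intros Hlt. specialize (H2 Hlt). specialize (H2' Hlt).
    eapply Rle_trans; [apply Rabs_triang|]. unfold Rdiv in *. lra.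
Qed.

Lemma gap_decay_ext p b K K' :
  (forall i j, K i j = K' i j) -> gap_decay p b K -> gap_decay p b K'.
Proof.
  intros E (C & HC & H). exists C. split; auto. intros i j. rewrite <- E. auto.
Qed.

(** One constant serves all sequences, since the bounds hold for each pair of
    indices; the gap is eventually positive when it tends to infinity. *)
Lemma estimate_of_gap_decay (p : nat) (b near far : nat -> nat -> R) X :
  gap_decay p b X ->
  (forall i j, b i j <= Rabs (near i j)) ->
  (forall i j, (j < i)%nat -> b i j / (omega i - omega j) ^ p <= Rabs (far i j)) ->
  estimate X near far.
Proof.
  intros (C & HC & H) Hn Hf. split; exists C; intros i j _ _ Hg.
  - apply filter_forall. intros m. eapply Rle_trans; [apply (proj1 (H _ _))|].
    apply Rmult_le_compat_l; auto.
  - assert (He : eventually (fun m => 0 < omega (i m) - omega (j m)))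
      by (apply (Hg (fun x => 0 < x)); exists 0; auto).
    revert He. apply filter_imp. intros m Hm.
    assert (Hlt : (j m < i m)%nat).
    { apply INR_lt. unfold omega in Hm. lra. }
    eapply Rle_trans; [apply (proj2 (H _ _) Hlt)|].
    unfold Rdiv. rewrite Rmult_assoc. apply Rmult_le_compat_l; auto. apply Hf; auto.
Qed.

Lemma growth_of_gap_decay p X : gap_decay p (fun i _ => omega i) X -> growth p X.
Proof.
  intros H. apply (estimate_of_gap_decay _ _ _ _ _ H).
  - intros i _. apply Rle_abs.
  - intros i j _. unfold sum_pm. eapply Rle_trans; [|apply Rle_abs].
    pose proof (Rabs_pos (omega i / (omega i + omega j) ^ p)).
    pose proof (Rle_abs (omega i / (omega i - omega j) ^ p)). lra.
Qed.

Lemma decay_of_gap_decay p q X : (q <= p)%nat ->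
  gap_decay p (fun i _ => / omega i) X -> decay q X.
Proof.
  intros Hq H. apply (estimate_of_gap_decay _ _ _ _ _ H).
  - intros i _. apply Rle_abs.
  - intros i j Hlt. unfold sum_pm. eapply Rle_trans; [|apply Rle_abs].
    pose proof (omega_ge_3 i).
    apply Rmult_le_compat_l. left; apply Rinv_0_lt_compat; lra.
    pose proof (Rabs_pos (1 / (omega i + omega j) ^ q)).
    pose proof (Rle_abs (1 / (omega i - omega j) ^ q)).
    assert (1 <= omega i - omega j).
    { apply le_INR in Hlt. rewrite S_INR in Hlt. unfold omega. lra. }
    assert (/ (omega i - omega j) ^ p <= / (omega i - omega j) ^ q).
    { apply Rinv_le_contravar; [apply pow_lt; lra|]. apply Rle_pow; auto. }
    unfold Rdiv in *. lra.
Qed.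

Lemma omega_prod_nonneg i j n : 0 <= omega i ^ n * omega j.
Proof.
  pose proof (omega_ge_3 i). pose proof (omega_ge_3 j).
  apply Rmult_le_pos; [apply pow_le|]; lra.
Qed.

Lemma mode_coef_prod : exists D, 0 < D /\ forall i j,
  mode_coef i * mode_coef j * (omega i * omega j) <= D.
Proof.
  destruct mode_coef_le as (C & HC & H). exists (C * C).
  split; [apply Rmult_lt_0_compat; auto|].
  intros i j. replace (mode_coef i * mode_coef j * (omega i * omega j))
    with ((mode_coef i * omega i) * (mode_coef j * omega j)) by ring.
  assert (P : forall i, 0 <= mode_coef i * omega i).
  { intros n. pose proof (mode_coef_pos n). pose proof (omega_ge_3 n). nra. }
  apply Rmult_le_compat; auto.
Qed.

(** Since [e_0'] is a multiple of [cos^2 sin], the weight [G e_0'] is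
    [sin cos] times the weight of a mixed kernel. *)
Lemma FFbar_decay (G : R -> R) (k : R) (n : nat) (p : trigpoly) :
  (1 <= n)%nat -> mixed_check n (mul_mono 1 1 0 p) = true ->
  (forall x, 0 < x < PI / 2 -> G x = k * eval p x) ->
  gap_decay (2 * n + 1) (fun i _ => omega i)
    (fun i j => omega 0 * omega i * FFbar G 0 j i).
Proof.
  intros Hn Hw HG. destruct mode_coef_prod as (D & HD & B).
  set (c := - 3 * e 0 0 * k).
  apply (gap_decay_ext _ _ (fun i j => c * (mode_coef i * mode_coef j * omega i)
                                       * mixed_kernel (mul_mono 1 1 0 p) i j)).
  - intros i j. unfold FFbar, c. pose proof (omega_ge_3 i). pose proof (omega_ge_3 0).
    rewrite (mixed_kernel_integral _ (- 3 * e 0 0 * k * (mode_coef i * mode_coef j) / omega 0)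
              (mul_mono 1 1 0 p) i j); [field; lra|].
    intros x Hx. pose proof (sin_pos_open x ltac:(lra)). pose proof (cos_pos_open x Hx).
    rewrite HG, e_mode, e'_0_eq, e'_comode, eval_mul_mono by auto. unfold tan. simpl. field.
    lra.
  - apply (gap_decay_scal _ (fun i j => omega i * omega j) _
      (fun i j => c * (mode_coef i * mode_coef j * omega i)) (Rabs c * D)).
    + apply Rmult_le_pos; [apply Rabs_pos|lra].
    + intros i j. rewrite <- (pow_1 (omega i)). apply omega_prod_nonneg.
    + intros i j. specialize (B i j). pose proof (mode_coef_pos i).
      pose proof (mode_coef_pos j).
      pose proof (omega_ge_3 i).
      rewrite Rabs_mult, (Rabs_pos_eq (_ * _ * _))
        by (apply Rmult_le_pos; [apply Rmult_le_pos|]; lra).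
      replace (Rabs c * (mode_coef i * mode_coef j * omega i) * (omega i * omega j))
        with (Rabs c * ((mode_coef i * mode_coef j * (omega i * omega j)) * omega i)) by ring.
      rewrite (Rmult_assoc (Rabs c) D). apply Rmult_le_compat_l; [apply Rabs_pos|].
      apply Rmult_le_compat_r; lra.
    + apply mixed_kernel_decay; auto.
Qed.

(** As [sin^3 / cos = sin cos tan^2], this is the mixed kernel of the weight
    [V sin cos], with two factors [omega_i] less than in [FFbar_decay]. *)
Lemma Q_integral_decay (V : R -> R) (k : R) (n : nat) (w : trigpoly) :
  (1 <= n)%nat -> mixed_check n (mul_mono 1 2 0 w) = true ->
  (forall x, 0 < x < PI / 2 -> V x = k * (cos x ^ 2 * eval w x)) ->
  gap_decay (2 * n + 1) (fun i _ => / omega i)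
    (fun i j => RInt (fun x =>
      V x * e j x * (e' i x / omega i) * (sin x ^ 3 / cos x)) 0 (PI / 2) / omega i).
Proof.
  intros Hn Hw HV. destruct mode_coef_prod as (D & HD & B).
  apply (gap_decay_ext _ _ (fun i j =>
    (k * (mode_coef i * mode_coef j) / omega i) * mixed_kernel (mul_mono 1 2 0 w) i j)).
  - intros i j. pose proof (omega_ge_3 i).
    rewrite (mixed_kernel_integral _ (k * (mode_coef i * mode_coef j)) (mul_mono 1 2 0 w) i j);
      [field; lra|].
    intros x Hx. pose proof (sin_pos_open x ltac:(lra)). pose proof (cos_pos_open x Hx).
    rewrite HV, e_mode, e'_comode, eval_mul_mono by auto. simpl. field. lra.
  - apply (gap_decay_scal _ (fun i j => omega i * omega j) _
      (fun i j => k * (mode_coef i * mode_coef j) / omega i) (Rabs k * D)).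
    + apply Rmult_le_pos; [apply Rabs_pos|lra].
    + intros i j. rewrite <- (pow_1 (omega i)). apply omega_prod_nonneg.
    + intros i j. specialize (B i j). pose proof (mode_coef_pos i).
      pose proof (mode_coef_pos j).
      pose proof (omega_ge_3 i). assert (0 < / omega i) by (apply Rinv_0_lt_compat; lra).
      unfold Rdiv. rewrite !Rabs_mult, (Rabs_pos_eq (mode_coef i)), (Rabs_pos_eq (mode_coef j)),
        (Rabs_pos_eq (/ omega i)) by lra.
      replace (Rabs k * (mode_coef i * mode_coef j) * / omega i * (omega i * omega j))
        with (Rabs k * ((mode_coef i * mode_coef j * (omega i * omega j)) * / omega i)) by ring.
      rewrite (Rmult_assoc (Rabs k) D). apply Rmult_le_compat_l; [apply Rabs_pos|].
      apply Rmult_le_compat_r; lra.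
    + apply mixed_kernel_decay; auto.
Qed.

Definition one_plus_2sin2 (w : trigpoly) : trigpoly := w ++ mul_mono 2 0 2 w.

(** Inserting [g_modes] gives [1 / (omega_i^2 - 4)] times a mixed and a plain kernel.
    The weight [w = V / cos^2] is the one for which both have polynomial weights. *)
Lemma Qbar_integral_decay (V : R -> R) (k : R) (n : nat) (w : trigpoly) :
  (2 <= n)%nat -> mixed_check n (mul_mono 1 2 0 w) = true ->
  plain_check n (one_plus_2sin2 w) = true ->
  (forall x, 0 < x < PI / 2 -> V x = k * (cos x ^ 2 * eval w x)) ->
  gap_decay (2 * n + 1) (fun i _ => / omega i)
    (fun i j => RInt (fun x => V x * e j x * g i x * tan x ^ 2) 0 (PI / 2)).
Proof.
  intros Hn Hw Hw' HV. destruct mode_coef_prod as (D & HD & B).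
  set (a := fun i j => k * (mode_coef i * mode_coef j) / (omega i ^ 2 - 4)).
  assert (Hw4 : forall i, 5 * omega i ^ 2 <= 9 * (omega i ^ 2 - 4)).
  { intros i. pose proof (omega_ge_3 i). nra. }
  assert (Hpos : forall i, 0 < omega i ^ 2 - 4).
  { intros i. pose proof (omega_ge_3 i). nra. }
  assert (Ha : forall i j, Rabs (a i j) * (omega i ^ 2 * omega j)
                            <= Rabs k * D * 2 * / omega i).
  { intros i j. unfold a. specialize (B i j). specialize (Hpos i). specialize (Hw4 i).
    pose proof (mode_coef_pos i). pose proof (mode_coef_pos j).
    pose proof (omega_ge_3 i). pose proof (omega_ge_3 j).
    assert (0 < / omega i) by (apply Rinv_0_lt_compat; lra).
    assert (0 < / (omega i ^ 2 - 4)) by (apply Rinv_0_lt_compat; lra).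
    unfold Rdiv. rewrite !Rabs_mult, (Rabs_pos_eq (mode_coef i)), (Rabs_pos_eq (mode_coef j)),
      (Rabs_pos_eq (/ _)) by lra.
    replace (Rabs k * (mode_coef i * mode_coef j) * / (omega i ^ 2 - 4)
             * (omega i ^ 2 * omega j))
      with (Rabs k * ((mode_coef i * mode_coef j * (omega i * omega j))
                      * (omega i ^ 2 * / (omega i ^ 2 - 4) * / omega i))) by (field; lra).
    replace (Rabs k * D * 2 * / omega i) with (Rabs k * (D * (2 * / omega i))) by ring.
    assert (omega i ^ 2 * / (omega i ^ 2 - 4) <= 2).
    { apply (Rmult_le_reg_r (omega i ^ 2 - 4)); auto. rewrite Rmult_assoc, Rinv_l by lra. lra. }
    assert (0 <= omega i ^ 2 * / (omega i ^ 2 - 4))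
      by (apply Rmult_le_pos; [apply pow2_ge_0|lra]).
    apply Rmult_le_compat_l; [apply Rabs_pos|]. apply Rmult_le_compat; auto.
    - apply Rmult_le_pos; apply Rmult_le_pos; lra.
    - apply Rmult_le_pos; lra.
    - apply Rmult_le_compat_r; lra. }
  apply (gap_decay_ext _ _ (fun i j => a i j * (omega i * mixed_kernel (mul_mono 1 2 0 w) i j
           + plain_kernel (one_plus_2sin2 w) i j))).
  - intros i j. unfold a. pose proof (omega_ge_3 i). specialize (Hpos i). pose proof PI_RGT_0.
    transitivity (RInt (fun x => k * (mode_coef i * mode_coef j) / (omega i ^ 2 - 4) *
      (omega i * (eval (mul_mono 1 2 0 w) x * mode j x * comode i x)
       + eval (one_plus_2sin2 w) x * mode j x * mode i x)) 0 (PI / 2)).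
    + symmetry. apply is_RInt_unique.
      apply (is_RInt_scal (V := R_NormedModule)
        (fun x => omega i * (eval (mul_mono 1 2 0 w) x * mode j x * comode i x)
                  + eval (one_plus_2sin2 w) x * mode j x * mode i x)).
      apply (is_RInt_plus (V := R_NormedModule)
        (fun x => omega i * (eval (mul_mono 1 2 0 w) x * mode j x * comode i x))).
      * apply (is_RInt_scal (V := R_NormedModule)
          (fun x => eval (mul_mono 1 2 0 w) x * mode j x * comode i x)).
        apply (RInt_correct (V := R_CompleteNormedModule)), ex_RInt_quarter.
        intros; apply continuous_kernel_integrand;
          auto using continuous_mode, continuous_comode.
      * apply (RInt_correct (V := R_CompleteNormedModule)), ex_RInt_quarter.
        intros; apply continuous_kernel_integrand;
          auto using continuous_mode, continuous_comode.
    + apply RInt_ext. intros x Hx. rewrite Rmin_left, Rmax_right in Hx by lra.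
      pose proof (sin_pos_open x ltac:(lra)). pose proof (cos_pos_open x Hx).
      rewrite HV, e_mode, g_modes, eval_mul_mono by auto.
      unfold one_plus_2sin2. rewrite eval_app, eval_mul_mono. unfold tan. real_equation.
      simpl. field. simpl in Hpos. lra.
  - apply (gap_decay_scal _ (fun i j => omega i ^ 2 * omega j) _ a (Rabs k * D * 2)).
    + apply Rmult_le_pos; [apply Rmult_le_pos; [apply Rabs_pos|]|]; lra.
    + intros i j. apply omega_prod_nonneg.
    + exact Ha.
    + apply gap_decay_plus; [|apply plain_kernel_decay; auto].
      apply (gap_decay_scal _ (fun i j => omega i * omega j) _ (fun i _ => omega i) 1);
        [lra| | |].
      * intros i j. rewrite <- (pow_1 (omega i)). apply omega_prod_nonneg.
      * intros i j. pose proof (omega_ge_3 i). rewrite Rabs_pos_eq by lra. right. ring.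
      * apply mixed_kernel_decay; auto. lia.
Qed.

(** * The weights and their endpoint derivatives *)

(** The open interval determines integrals and endpoint limits; the scalar is nonzero
    so that non-vanishing derivatives can be read off from the polynomial. *)
Definition represented (W : R -> R) (p : trigpoly) : Prop :=
  exists k, k <> 0 /\ forall x, 0 < x < PI / 2 -> W x = k * eval p x.

Lemma RInt_represented (f : R -> R) (c : R) (a b : nat) (x : R) : 0 < x < PI / 2 ->
  (forall y, 0 < y < PI / 2 -> f y = c * (cos y ^ a * sin y ^ b)) ->
  RInt f 0 x = c * RInt (fun y => cos y ^ a * sin y ^ b) 0 x :> R.
Proof.
  intros Hx Hf. rewrite <- (RInt_scal (V := R_CompleteNormedModule)).
  - apply RInt_ext. intros y Hy. rewrite Rmin_left, Rmax_right in Hy by lra. apply Hf. lra.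
  - apply (ex_RInt_continuous (V := R_CompleteNormedModule)). intros.
    apply continuous_cos_sin_pow.
Qed.

(** A multiple of [Gamma1], whose factor [1 / sin] has been absorbed in [quotient24]. *)
Definition weight1 : trigpoly := mul_mono 1 3 0 quotient24.
Definition weight2 : trigpoly := mul_mono 1 3 0 quotient42.
(** Twenty-four times [int_0^x cos^5 sin^3]. *)
Definition weight3 : trigpoly := [Mono 6 0 4 false; Mono (-8) 0 6 false; Mono 3 0 8 false].
(** Eight times [int_0^x cos^7 sin]. *)
Definition weight4 : trigpoly := [Mono 1 0 0 false; Mono (-1) 8 0 false].
Definition weight_one : trigpoly := [Mono 1 0 0 false].

Lemma quotient_denominator_pos : 0 < IZR quotient_denominator.
Proof. apply (IZR_lt 0). reflexivity. Qed.

Lemma e_0_0_sq_pos : 0 < e 0 0 ^ 2.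
Proof. pose proof e_0_0_neq_0. simpl. nra. Qed.

Lemma Gamma1_represented : represented Gamma1 weight1.
Proof.
  pose proof quotient_denominator_pos as Hd. pose proof e_0_0_sq_pos.
  exists (9 * e 0 0 ^ 2 / IZR quotient_denominator). split.
  { apply Rgt_not_eq, Rdiv_lt_0_compat; lra. }
  intros x Hx. unfold Gamma1. pose proof (sin_pos_open x ltac:(lra)).
  rewrite (RInt_represented _ (9 * e 0 0 ^ 2) 2 4) by
   (auto; intros y Hy; pose proof (cos_pos_open y Hy); rewrite e'_0_eq; unfold tan; field; lra).
  rewrite RInt_cos2_sin4 by lra. unfold weight1. rewrite eval_mul_mono. simpl. field. lra.
Qed.

Lemma omega_0 : omega 0 = 3.
Proof. unfold omega. simpl. ring. Qed.

Lemma Gamma2_represented : represented Gamma2 weight2.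
Proof.
  pose proof quotient_denominator_pos as Hd. pose proof e_0_0_sq_pos.
  exists (9 * e 0 0 ^ 2 / (3 * IZR quotient_denominator)). split.
  { apply Rgt_not_eq, Rdiv_lt_0_compat; lra. }
  intros x Hx. unfold Gamma2. pose proof (sin_pos_open x ltac:(lra)).
  rewrite (RInt_represented _ (e 0 0 ^ 2) 4 2) by
   (auto; intros y Hy; pose proof (cos_pos_open y Hy); rewrite e_0_eq; unfold tan; field; lra).
  rewrite RInt_cos4_sin2, omega_0 by lra. unfold weight2. rewrite eval_mul_mono. simpl. field.
  lra.
Qed.

Lemma Gamma3_represented : represented Gamma3 weight3.
Proof.
  pose proof e_0_0_sq_pos. exists (9 * e 0 0 ^ 2 / 24). split; [lra|].
  intros x Hx. unfold Gamma3.
  rewrite (RInt_represented _ (9 * e 0 0 ^ 2) 5 3) by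
   (auto; intros y Hy; rewrite e'_0_eq; ring).
  rewrite RInt_cos5_sin3. unfold weight3. real_equation. field.
Qed.

Lemma Gamma4_represented : represented Gamma4 weight4.
Proof.
  pose proof e_0_0_sq_pos. exists (9 * e 0 0 ^ 2 / 8). split; [lra|].
  intros x Hx. unfold Gamma4.
  rewrite (RInt_represented _ (e 0 0 ^ 2) 7 1) by
   (auto; intros y Hy; rewrite e_0_eq; ring).
  rewrite RInt_cos7_sin, omega_0. unfold weight4. real_equation. field.
Qed.

Lemma one_represented : represented (fun _ => 1) weight_one.
Proof. exists 1. split; [lra|]. intros x _. unfold eval, eval_mono. simpl. ring. Qed.

Lemma represented_mul_cos_sin W p k a b f :
  represented W p -> k <> 0 -> (forall x, f x = k * (cos x ^ a * sin x ^ b)) ->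
  represented (fun x => W x * f x) (mul_mono 1 a b p).
Proof.
  intros (c & Hc & HW) Hk Hf. exists (c * k).
  split; [apply Rmult_integral_contrapositive; auto|].
  intros x Hx. rewrite HW, Hf, eval_mul_mono by auto. ring.
Qed.

Lemma represented_ext W W' p :
  (forall x, W x = W' x) -> represented W p -> represented W' p.
Proof. intros E (k & Hk & H). exists k. split; auto. intros x Hx. rewrite <- E; auto. Qed.

Lemma growth_FFbar G p n :
  represented G p -> (1 <= n)%nat -> mixed_check n (mul_mono 1 1 0 p) = true ->
  growth (2 * n + 1) (fun i j => omega 0 * omega i * FFbar G 0 j i).
Proof.
  intros (k & _ & HG) Hn Hw. apply growth_of_gap_decay. apply (FFbar_decay G k n p); auto.
Qed.

Lemma GGbar_eq k j i : GGbar k j i = FFbar (fun _ => 1) k j i.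
Proof. apply RInt_ext. intros x _. real_equation. ring. Qed.

Lemma decay_QQ V p n q :
  (exists k, forall x, 0 < x < PI / 2 -> V x = k * (cos x ^ 2 * eval p x)) ->
  (2 <= n)%nat -> (q <= 2 * n + 1)%nat -> mixed_check n (mul_mono 1 2 0 p) = true ->
  decay q (fun i j => RInt (fun x =>
      V x * e j x * (e' i x / omega i) * (sin x ^ 3 / cos x)) 0 (PI / 2) / omega i).
Proof.
  intros (k & HV) Hn Hq Hw. apply (decay_of_gap_decay _ _ _ Hq).
  apply (Q_integral_decay V k n p); auto. lia.
Qed.

Lemma decay_QQbar V p n q :
  (exists k, forall x, 0 < x < PI / 2 -> V x = k * (cos x ^ 2 * eval p x)) ->
  (2 <= n)%nat -> (q <= 2 * n + 1)%nat -> mixed_check n (mul_mono 1 2 0 p) = true ->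
  plain_check n (one_plus_2sin2 p) = true ->
  decay q (fun i j => RInt (fun x => V x * e j x * g i x * tan x ^ 2) 0 (PI / 2)).
Proof.
  intros (k & HV) Hn Hq Hw Hw'. apply (decay_of_gap_decay _ _ _ Hq).
  apply (Qbar_integral_decay V k n p); auto.
Qed.

Lemma Derive_n_represented (F : R -> R) (k : R) (p : trigpoly) (q : nat) :
  (forall x, 0 < x < PI / 2 -> F x = k * eval p x) ->
  (forall r, (r < q)%nat -> differentiable (Nat.iter r deriv p) = true) ->
  forall x, 0 < x < PI / 2 -> Derive_n F q x = k * eval (Nat.iter q deriv p) x.
Proof.
  intros HF. induction q as [|q IH]; intros Hd x Hx; [apply HF, Hx|].
  simpl. apply is_derive_unique.
  apply (is_derive_ext_loc (fun y => k * eval (Nat.iter q deriv p) y)).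
  - apply (filter_imp (fun y => 0 < y < PI / 2)); [|apply interior_locally, Hx].
    intros y Hy. symmetry. apply IH; auto.
  - apply (is_derive_scal (eval (Nat.iter q deriv p))). apply is_derive_eval; auto. lra.
Qed.

Lemma smooth_inside_represented (F : R -> R) (k : R) (p : trigpoly) (q : nat) :
  (forall x, 0 < x < PI / 2 -> F x = k * eval p x) ->
  (forall r, (r < q)%nat -> differentiable (Nat.iter r deriv p) = true) ->
  smooth_inside F q.
Proof.
  intros HF Hd x Hx. destruct q as [|q]; simpl; auto.
  exists (k * eval (deriv (Nat.iter q deriv p)) x).
  apply (is_derive_ext_loc (fun y => k * eval (Nat.iter q deriv p) y)).
  - apply (filter_imp (fun y => 0 < y < PI / 2)); [|apply interior_locally, Hx].
    intros y Hy. symmetry. apply Derive_n_represented; auto.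
  - apply (is_derive_scal (eval (Nat.iter q deriv p))). apply is_derive_eval; auto. lra.
Qed.

Lemma deriv_at_ends (F : R -> R) (k : R) (p : trigpoly) (q : nat) :
  (forall x, 0 < x < PI / 2 -> F x = k * eval p x) ->
  (forall r, (r < q)%nat -> differentiable (Nat.iter r deriv p) = true) ->
  deriv_at_0 F q (k * eval (Nat.iter q deriv p) 0) /\
  deriv_at_PI2 F q (k * eval (Nat.iter q deriv p) (PI / 2)).
Proof.
  intros HF Hd. pose proof PI_RGT_0.
  assert (C : forall x, 0 <= x <= PI / 2 ->
    continuous (fun y => k * eval (Nat.iter q deriv p) y) x).
  { intros x Hx. apply (continuous_scal_r (V := R_NormedModule) k (eval _)).
    apply continuous_eval, Hx. }
  assert (E : forall x, 0 < x < PI / 2 -> k * eval (Nat.iter q deriv p) x = Derive_n F q x).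
  { intros x Hx. symmetry. apply Derive_n_represented; auto. }
  assert (Hp : 0 < PI / 2) by lra.
  split; (split; [eapply smooth_inside_represented; eauto|]).
  - apply (filterlim_ext_loc (fun y => k * eval (Nat.iter q deriv p) y)).
    + exists (mkposreal _ Hp). intros y Hy Hy0. apply E.
      change (Rabs (y - 0) < PI / 2) in Hy. rewrite Rminus_0_r, Rabs_pos_eq in Hy; lra.
    + intros P HP. destruct (C 0 ltac:(lra) P HP) as [d Hdd]. exists d. intros y Hy _.
      apply Hdd, Hy.
  - apply (filterlim_ext_loc (fun y => k * eval (Nat.iter q deriv p) y)).
    + exists (mkposreal _ Hp). intros y Hy Hy0. apply E.
      change (Rabs (y - PI / 2) < PI / 2) in Hy. rewrite Rabs_left in Hy; lra.
    + intros P HP. destruct (C (PI / 2) ltac:(lra) P HP) as [d Hdd]. exists d. intros y Hy _.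
      apply Hdd, Hy.
Qed.

Lemma even_derivatives_vanish_iter n p r : (r <= n)%nat ->
  even_derivatives_vanish n p = true ->
  even_derivatives_vanish (n - r) (Nat.iter (2 * r) deriv p) = true.
Proof.
  revert n p. induction r as [|r IH]; intros n p Hr H.
  - rewrite Nat.sub_0_r. exact H.
  - destruct n as [|n]; [lia|]. simpl in H.
    apply andb_prop in H as [_ H]. apply andb_prop in H as [_ H].
    replace (2 * S r)%nat with (2 * r + 2)%nat by lia. rewrite Nat.iter_add. simpl Nat.sub.
    apply IH; auto. lia.
Qed.

Lemma even_derivatives_vanish_differentiable n p r : (r <= 2 * n + 1)%nat ->
  even_derivatives_vanish n p = true -> differentiable (Nat.iter r deriv p) = true.
Proof.
  intros Hr H. destruct (Nat.Even_or_Odd r) as [[s ->]|[s ->]];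
    pose proof (even_derivatives_vanish_iter n p s ltac:(lia) H) as H';
    destruct (n - s)%nat; simpl in H';
    repeat match goal with H : _ && _ = true |- _ => apply andb_prop in H as [? ?] end; auto;
    rewrite Nat.add_1_r; auto.
Qed.

Lemma even_derivatives_vanish_0 n p r : (r <= n)%nat ->
  even_derivatives_vanish n p = true -> eval (Nat.iter (2 * r) deriv p) 0 = 0.
Proof.
  intros Hr H. apply (even_derivatives_vanish_iter n p r Hr) in H.
  rewrite eval_0. destruct (n - r)%nat; cbn [even_derivatives_vanish] in H;
    repeat match goal with H : _ && _ = true |- _ => apply andb_prop in H as [? ?] end;
    match goal with H : Z.eqb _ 0 = true |- _ => apply Z.eqb_eq in H; rewrite H; auto end.
Qed.

Lemma even_derivatives_vanish_PI2 n p r : (r < n)%nat ->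
  even_derivatives_vanish n p = true -> eval (Nat.iter (2 * r) deriv p) (PI / 2) = 0.
Proof.
  intros Hr H. apply (even_derivatives_vanish_iter n p r ltac:(lia)) in H.
  replace (n - r)%nat with (S (n - r - 1)) in H by lia. cbn [even_derivatives_vanish] in H.
  apply andb_prop in H as [_ H]. apply andb_prop in H as [H _].
  unfold vanishes_at_PI2 in H. apply andb_prop in H as [H1 H2].
  apply Z.eqb_eq in H1, H2. rewrite eval_PI2, H1, H2. ring.
Qed.

(** The part with [sin16_ratio] is required to drop out at order [2n], so that the
    derivative there is a nonzero integer up to the scalar. *)
Definition first_nonvanishing_check (n : nat) (p : trigpoly) : bool :=
  even_derivatives_vanish n p
  && negb (Z.eqb (value_at_PI2 false (Nat.iter (2 * n) deriv p)) 0)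
  && Z.eqb (value_at_PI2 true (Nat.iter (2 * n) deriv p)) 0.

Lemma first_nonvanishing_of_check F p n :
  represented F p -> first_nonvanishing_check n p = true -> first_nonvanishing F (2 * n).
Proof.
  intros (k & Hk & HF) H. apply andb_prop in H as [H H2]. apply andb_prop in H as [H H1].
  apply Z.eqb_eq in H2. apply negb_true_iff, Z.eqb_neq in H1.
  assert (Hd : forall q, (q <= 2 * n)%nat -> forall r, (r < q)%nat ->
    differentiable (Nat.iter r deriv p) = true).
  { intros q Hq r Hr. apply (even_derivatives_vanish_differentiable n); auto. lia. }
  split; [exists n; auto|]. split.
  - intros q [r ->] Hlt.
    destruct (deriv_at_ends F k p (2 * r) HF (Hd (2 * r)%nat ltac:(lia))) as [A B].
    rewrite (even_derivatives_vanish_0 n), Rmult_0_r in A by (auto; lia).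
    rewrite (even_derivatives_vanish_PI2 n), Rmult_0_r in B by (auto; lia). auto.
  - exists (k * eval (Nat.iter (2 * n) deriv p) (PI / 2)). split.
    + rewrite eval_PI2, H2, Rmult_0_l, Rplus_0_r.
      apply Rmult_integral_contrapositive. split; auto. apply (eq_IZR_contrapositive _ 0); auto.
    + apply (deriv_at_ends F k p _ HF (Hd (2 * n)%nat (le_n _))).
Qed.

Lemma none_nonvanishing_of_parity F p :
  represented F p -> parity true true p = true -> none_nonvanishing F.
Proof.
  intros (k & Hk & HF) H q [r ->].
  assert (Hv := odd_odd_even_derivatives_vanish p (S r) H).
  destruct (deriv_at_ends F k p (2 * r) HF) as [A B].
  { intros s Hs. apply (even_derivatives_vanish_differentiable (S r)); auto. lia. }
  rewrite (even_derivatives_vanish_0 (S r)), Rmult_0_r in A by (auto; lia).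
  rewrite (even_derivatives_vanish_PI2 (S r)), Rmult_0_r in B by (auto; lia). auto.
Qed.

Lemma represented_mul_e_0 G p : represented G p ->
  exists k, forall x, 0 < x < PI / 2 ->
    G x * e 0 x = k * (cos x ^ 2 * eval (mul_mono 1 1 0 p) x).
Proof.
  intros (k & _ & HG). exists (k * e 0 0). intros x Hx.
  rewrite HG, e_0_eq, eval_mul_mono by auto. simpl. ring.
Qed.

Lemma decay_QQ_G G p n : represented G p -> (2 <= n)%nat ->
  mixed_check n (mul_mono 1 2 0 (mul_mono 1 1 0 p)) = true ->
  decay (2 * n + 1) (fun i j => QQ G 0 j i / omega i).
Proof.
  intros HG Hn Hw.
  exact (decay_QQ (fun x => G x * e 0 x) _ n _ (represented_mul_e_0 G p HG) Hn (le_n _) Hw).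
Qed.
Lemma decay_QQbar_G G p n : represented G p -> (2 <= n)%nat ->
  mixed_check n (mul_mono 1 2 0 (mul_mono 1 1 0 p)) = true ->
  plain_check n (one_plus_2sin2 (mul_mono 1 1 0 p)) = true ->
  decay (2 * n + 1) (fun i j => QQbar G 0 j i).
Proof.
  intros HG Hn Hw Hw'.
  exact (decay_QQbar (fun x => G x * e 0 x) _ n _
           (represented_mul_e_0 G p HG) Hn (le_n _) Hw Hw').
Qed.

Lemma II_eq j k i : II j k i = QQ (fun _ => 1) j k i.
Proof. apply RInt_ext. intros x _. real_equation. ring. Qed.
Lemma IIbar_eq j k i : IIbar j k i = QQbar (fun _ => 1) j k i.
Proof. apply RInt_ext. intros x _. real_equation. ring. Qed.

Lemma parity_mul_mono z a b p c d :
  parity a b p = true ->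
  parity (xorb (Nat.odd c) a) (xorb (Nat.odd d) b) (mul_mono z c d p) = true.
Proof.
  unfold parity, mul_mono. rewrite !forallb_forall. intros H t Ht.
  apply in_map_iff in Ht as [u [<- Hu]]. specialize (H u Hu). cbn [coef cexp sexp has_ratio].
  rewrite !Nat.odd_add. apply andb_prop in H as [H H3]. apply andb_prop in H as [H1 H2].
  apply eqb_prop in H2, H3. rewrite H1, H2, H3, !eqb_reflx. auto.
Qed.

Lemma parity_app a b p q :
  parity a b p = true -> parity a b q = true -> parity a b (p ++ q) = true.
Proof. unfold parity. intros H1 H2. rewrite forallb_app, H1, H2. auto. Qed.

(** Cosine integrals see the odd derivatives, and one differentiation turns even
    exponents into odd ones. *)
Lemma even_even_cos_order_check n p : parity false false p = true -> cos_order_check n p = true.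
Proof.
  intros H. unfold cos_order_check. rewrite (parity_differentiable _ _ _ H). simpl.
  apply odd_odd_even_derivatives_vanish, (parity_deriv _ _ _ H).
Qed.

Lemma even_even_mixed_check n w : parity false false w = true -> mixed_check n w = true.
Proof.
  intros H. unfold mixed_check.
  rewrite odd_odd_even_derivatives_vanish by (apply (parity_mul_mono 1 false false _ 1 1 H)).
  rewrite !even_even_cos_order_check; auto.
  apply (parity_mul_mono 1 false false _ 0 2 H). apply (parity_mul_mono 1 false false _ 2 0 H).
Qed.
Lemma even_even_plain_check n w : parity false false w = true -> plain_check n w = true.
Proof.
  intros H. unfold plain_check.
  rewrite odd_odd_even_derivatives_vanish by (apply (parity_mul_mono 1 false false _ 1 1 H)).
  rewrite !even_even_cos_order_check; auto.
  apply (parity_mul_mono 1 false false _ 0 2 H). apply (parity_mul_mono 1 false false _ 2 0 H).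
Qed.

Lemma decay_scal q c X : decay q X -> decay q (fun i j => c * X i j).
Proof.
  assert (A : forall x y C, Rabs x <= C * y -> Rabs (c * x) <= Rabs c * C * y).
  { intros x y C H. rewrite Rabs_mult, Rmult_assoc.
    apply Rmult_le_compat_l; auto using Rabs_pos. }
  intros [[C1 H1] [C2 H2]]. split; [exists (Rabs c * C1)|exists (Rabs c * C2)];
  intros i j Hi Hj Hg; [generalize (H1 i j Hi Hj Hg)|generalize (H2 i j Hi Hj Hg)];
  apply filter_imp; intros m Hm; auto.
Qed.

Lemma estimate_ext near far X Y :
  (forall i j, X i j = Y i j) -> estimate X near far -> estimate Y near far.
Proof.
  intros E [[C1 H1] [C2 H2]]. split; [exists C1|exists C2];
  intros i j Hi Hj Hg; [generalize (H1 i j Hi Hj Hg)|generalize (H2 i j Hi Hj Hg)];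
  apply filter_imp; intros m Hm; rewrite <- E; auto.
Qed.

(** The checks hold for every [k] at once, so the order of decay is arbitrary. *)
Lemma decay_any_order_of_even_even V p N : parity false false p = true ->
  (exists k, forall x, 0 < x < PI / 2 -> V x = k * (cos x ^ 2 * eval p x)) ->
  decay N (fun i j => RInt (fun x =>
      V x * e j x * (e' i x / omega i) * (sin x ^ 3 / cos x)) 0 (PI / 2) / omega i) /\
  decay N (fun i j => RInt (fun x => V x * e j x * g i x * tan x ^ 2) 0 (PI / 2)).
Proof.
  intros Hp HV. split.
  - apply (decay_QQ V p (N + 2)); auto; [lia..|].
    apply even_even_mixed_check. apply (parity_mul_mono 1 _ _ _ 2 0 Hp).
  - apply (decay_QQbar V p (N + 2)); auto; [lia..| |].
    apply even_even_mixed_check. apply (parity_mul_mono 1 _ _ _ 2 0 Hp).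
    apply even_even_plain_check. apply parity_app; auto.
    apply (parity_mul_mono 2 _ _ _ 0 2 Hp).
Qed.

Theorem proposition4p3 (N : nat) :
  (growth 9 (fun i j => omega 0 * omega i * FFbar Gamma1 0 j i) /\
   growth 11 (fun i j => omega 0 * omega i * FFbar Gamma2 0 j i) /\
   growth 3 (fun i j => omega 0 * omega i * FFbar Gamma3 0 j i) /\
   growth 3 (fun i j => omega 0 * omega i * FFbar Gamma4 0 j i) /\
   growth 3 (fun i j => omega 0 * omega i * GGbar 0 j i)) /\
  (decay 11 (fun i j => QQbar Gamma1 0 j i) /\
   decay 11 (fun i j => QQ Gamma1 0 j i / omega i) /\
   decay 13 (fun i j => QQbar Gamma2 0 j i) /\
   decay 13 (fun i j => QQ Gamma2 0 j i / omega i) /\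
   decay 5 (fun i j => QQbar Gamma3 0 j i) /\
   decay 5 (fun i j => QQ Gamma3 0 j i / omega i) /\
   decay 5 (fun i j => QQbar Gamma4 0 j i) /\
   decay 5 (fun i j => QQ Gamma4 0 j i / omega i) /\
   decay 5 (fun i j => IIbar 0 j i) /\
   decay 5 (fun i j => II 0 j i / omega i) /\
   decay N (fun i j => omega 0 ^ 2 * RRbar 0 0 j i) /\
   decay N (fun i j => omega 0 ^ 2 * RR 0 0 j i / omega i) /\
   decay N (fun i j => SSbar 0 0 j i) /\
   decay N (fun i j => SS 0 0 j i / omega i)) /\
  (first_nonvanishing (fun x => Gamma1 x * e' 0 x) 8 /\
   first_nonvanishing (fun x => Gamma2 x * e' 0 x) 10 /\
   first_nonvanishing (fun x => Gamma3 x * e' 0 x) 2 /\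
   first_nonvanishing (fun x => Gamma4 x * e' 0 x) 2 /\
   first_nonvanishing (fun x => e' 0 x) 2 /\
   first_nonvanishing (fun x => Gamma1 x * e 0 x * sin x * cos x) 10 /\
   first_nonvanishing (fun x => Gamma2 x * e 0 x * sin x * cos x) 12 /\
   first_nonvanishing (fun x => Gamma3 x * e 0 x * sin x * cos x) 4 /\
   first_nonvanishing (fun x => Gamma4 x * e 0 x * sin x * cos x) 4 /\
   first_nonvanishing (fun x => e 0 x * sin x * cos x) 4 /\
   none_nonvanishing (fun x => e' 0 x ^ 2 * sin x * cos x) /\
   none_nonvanishing (fun x => e 0 x ^ 2 * sin x * cos x)).
Proof.
  assert (GE' : forall G p, represented G p -> represented
    (fun x => G x * e' 0 x) (mul_mono 1 2 1 p)).
  { intros G p H. pose proof e_0_0_neq_0.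
    apply (represented_mul_cos_sin G p (- 3 * e 0 0)); auto; [lra|].
    intros x. rewrite e'_0_eq. ring. }
  assert (GE : forall G p, represented G p ->
    represented (fun x => G x * e 0 x * sin x * cos x) (mul_mono 1 4 1 p)).
  { intros G p H. pose proof e_0_0_neq_0.
    apply (represented_ext (fun x => G x * (e 0 x * sin x * cos x))); [intros; ring|].
    apply (represented_mul_cos_sin G p (e 0 0)); auto.
    intros x. rewrite e_0_eq. ring. }
  pose proof Gamma1_represented as G1. pose proof Gamma2_represented as G2.
  pose proof Gamma3_represented as G3. pose proof Gamma4_represented as G4.
  pose proof one_represented as G5.
  split; [|split].
  - split; [|split; [|split; [|split]]].
    + apply (growth_FFbar _ _ 4 G1); [lia|vm_compute; reflexivity].
    + apply (growth_FFbar _ _ 5 G2); [lia|vm_compute; reflexivity].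
    + apply (growth_FFbar _ _ 1 G3); [lia|vm_compute; reflexivity].
    + apply (growth_FFbar _ _ 1 G4); [lia|vm_compute; reflexivity].
    + apply (estimate_ext _ _ (fun i j => omega 0 * omega i * FFbar (fun _ => 1) 0 j i)).
      { intros i j. rewrite GGbar_eq. auto. }
      apply (growth_FFbar _ _ 1 G5); [lia|vm_compute; reflexivity].
  - split; [apply (decay_QQbar_G _ _ 5 G1); [lia|vm_compute; reflexivity..]|].
    split; [apply (decay_QQ_G _ _ 5 G1); [lia|vm_compute; reflexivity]|].
    split; [apply (decay_QQbar_G _ _ 6 G2); [lia|vm_compute; reflexivity..]|].
    split; [apply (decay_QQ_G _ _ 6 G2); [lia|vm_compute; reflexivity]|].
    split; [apply (decay_QQbar_G _ _ 2 G3); [lia|vm_compute; reflexivity..]|].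
    split; [apply (decay_QQ_G _ _ 2 G3); [lia|vm_compute; reflexivity]|].
    split; [apply (decay_QQbar_G _ _ 2 G4); [lia|vm_compute; reflexivity..]|].
    split; [apply (decay_QQ_G _ _ 2 G4); [lia|vm_compute; reflexivity]|].
    split.
    { apply (estimate_ext _ _ (fun i j => QQbar (fun _ => 1) 0 j i)).
      intros i j; symmetry; apply IIbar_eq.
      apply (decay_QQbar_G _ _ 2 G5); [lia|vm_compute; reflexivity..]. }
    split.
    { apply (estimate_ext _ _ (fun i j => QQ (fun _ => 1) 0 j i / omega i)).
      intros i j; rewrite II_eq; auto.
      apply (decay_QQ_G _ _ 2 G5); [lia|vm_compute; reflexivity..]. }
    destruct (decay_any_order_of_even_even (fun x => (e' 0 x / omega 0) ^ 2)
      [Mono 1 2 2 false] N eq_refl)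
      as [R1 R2].
    { exists (e 0 0 ^ 2). intros x _. rewrite e'_0_eq, omega_0.
      unfold eval, eval_mono. simpl. field. }
    destruct (decay_any_order_of_even_even (fun x => e 0 x * e 0 x)
      [Mono 1 4 0 false] N eq_refl)
      as [S1 S2].
    { exists (e 0 0 ^ 2). intros x _. rewrite e_0_eq. unfold eval, eval_mono. simpl. ring. }
    split; [|split; [|split]].
    + apply decay_scal. revert R2. apply estimate_ext. intros i j.
      apply RInt_ext. intros x _. real_equation. ring.
    + apply (decay_scal N (omega 0 ^ 2)) in R1. revert R1. apply estimate_ext. intros i j.
      match goal with |- _ * (?a / _) = _ => assert (E : a = RR 0 0 j i) end.
      { apply RInt_ext. intros x _. real_equation. ring. }
      rewrite E. field. pose proof (omega_ge_3 i). lra.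
    + exact S2.
    + exact S1.
  - split; [apply (first_nonvanishing_of_check _ _ 4 (GE' _ _ G1)); vm_compute; reflexivity|].
    split; [apply (first_nonvanishing_of_check _ _ 5 (GE' _ _ G2)); vm_compute; reflexivity|].
    split; [apply (first_nonvanishing_of_check _ _ 1 (GE' _ _ G3)); vm_compute; reflexivity|].
    split; [apply (first_nonvanishing_of_check _ _ 1 (GE' _ _ G4)); vm_compute; reflexivity|].
    split.
    { apply (first_nonvanishing_of_check _ (mul_mono 1 2 1 weight_one) 1);
        [|vm_compute; reflexivity].
      apply (represented_ext _ _ _ (fun x => Rmult_1_l _) (GE' _ _ G5)). }
    split; [apply (first_nonvanishing_of_check _ _ 5 (GE _ _ G1)); vm_compute; reflexivity|].
    split; [apply (first_nonvanishing_of_check _ _ 6 (GE _ _ G2)); vm_compute; reflexivity|].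
    split; [apply (first_nonvanishing_of_check _ _ 2 (GE _ _ G3)); vm_compute; reflexivity|].
    split; [apply (first_nonvanishing_of_check _ _ 2 (GE _ _ G4)); vm_compute; reflexivity|].
    split.
    { apply (first_nonvanishing_of_check _ (mul_mono 1 4 1 weight_one) 2);
        [|vm_compute; reflexivity].
      refine (represented_ext _ _ _ _ (GE _ _ G5)). intros x; ring. }
    split.
    + apply (none_nonvanishing_of_parity _ [Mono 1 5 3 false]); [|reflexivity].
      pose proof e_0_0_neq_0. exists (9 * e 0 0 ^ 2). split; [simpl; nra|].
      intros x _. rewrite e'_0_eq. unfold eval, eval_mono. simpl. ring.
    + apply (none_nonvanishing_of_parity _ [Mono 1 7 1 false]); [|reflexivity].
      pose proof e_0_0_neq_0. exists (e 0 0 ^ 2). split; [simpl; nra|].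
      intros x _. rewrite e_0_eq. unfold eval, eval_mono. simpl. ring.
Qed.
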